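(* Let $\lambda$ be a limit ordinal and let $\mathcal{H}$ be a nonempty subset of $\mathcal{E}_\lambda$ such that for each $\theta<\lambda$ the set $\{h\in\mathcal{H} : \mathrm{cr}\,h<\theta\}$ is finite. Then the set of ordinals $\mathrm{cr}\,\mathcal{A}_{\mathcal{H}}=\{\mathrm{cr}\,k : k\in\mathcal{A}_{\mathcal{H}}\}$ has order type $\omega$.
   Context: For a limit ordinal $\lambda$, $\mathcal{E}_\lambda$ is the set of all elementary embeddings $j:(V_\lambda,\in)\to(V_\lambda,\in)$ that are not the identity; $\mathrm{cr}\,j$ denotes the critical point of $j$. For $j,k\in\mathcal{E}_\lambda$ define the application $j\cdot k=\bigcup_{\alpha<\lambda} j(k\cap V_\alpha)$ (where $k$ is regarded as a set of ordered pairs); then $j\cdot k\in\mathcal{E}_\lambda$. For $\mathcal{H}\subseteq\mathcal{E}_\lambda$, $\mathcal{A}_{\mathcal{H}}$ is the closure of $\mathcal{H}$ under the operation $\cdot$ (the smallest set containing $\mathcal H$ and closed under $\cdot$). *)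

(* Defs.v *)
From HB Require Import structures.
From mathcomp Require Import all_boot.
From mathcomp Require Import boolp classical_sets functions cardinality.

Set Implicit Arguments.
Unset Strict Implicit.
Unset Printing Implicit Defensive.

Local Open Scope classical_set_scope.
Local Open Scope quotient_scope.

(** * The universe of sets

    Aczel's well-founded trees modulo extensional equality.  With the classical
    axioms of [boolp] this is a model of ZFC in which every bounded class
    [set zfset] is a set, so [set zfset] serves for classes and for subsets. *)

Inductive tree : Type := Sup (A : Type) of A -> tree.

Fixpoint treq (x y : tree) : Prop :=
  match x, y with
  | Sup A f, Sup B g =>
      (forall a, exists b, treq (f a) (g b)) /\
      (forall b, exists a, treq (f a) (g b))
  end.

Lemma treq_refl x : treq x x.
Proof. by elim: x => A f IH /=; split=> a; exists a. Qed.

Lemma treq_sym x y : treq x y -> treq y x.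
Proof.
elim: x y => A f IH [B g] /= [fg gf]; split=> [b|a].
  by have [a /IH] := gf b; exists a.
by have [b /IH] := fg a; exists b.
Qed.

Lemma treq_trans y x z : treq x y -> treq y z -> treq x z.
Proof.
elim: x y z => A f IH [B g] [C h] /= [fg gf] [gh hg]; split=> [a|c].
  have [b fgab] := fg a; have [c ghbc] := gh b.
  by exists c; apply: IH fgab ghbc.
have [b ghbc] := hg c; have [a fgab] := gf b.
by exists a; apply: IH fgab ghbc.
Qed.

HB.instance Definition _ := gen_eqMixin tree.
HB.instance Definition _ := gen_choiceMixin tree.

Definition treqb (x y : tree) : bool := `[< treq x y >].

Lemma treqb_refl : reflexive treqb.
Proof. by move=> x; apply/asboolP/treq_refl. Qed.

Lemma treqb_sym : symmetric treqb.
Proof. by move=> x y; apply/asboolP/asboolP; apply: treq_sym. Qed.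

Lemma treqb_trans : transitive treqb.
Proof.
by move=> y x z /asboolP xy /asboolP yz; apply/asboolP/(treq_trans xy yz).
Qed.

Canonical treqb_equiv := EquivRel treqb treqb_refl treqb_sym treqb_trans.

Definition zfset := {eq_quot treqb_equiv}.

Definition branches (t : tree) : Type := let: Sup A _ := t in A.
Definition subtree (t : tree) : branches t -> tree :=
  match t with Sup A f => f end.

(** [idx x] is a small type indexing the elements [elt i] of [x]. *)
Definition idx (x : zfset) : Type := branches (repr x).
Definition elt (x : zfset) (i : idx x) : zfset :=
  \pi_zfset (subtree i).

Definition zmem (y x : zfset) : Prop := exists i : idx x, elt i = y.
Notation "y ∈ x" := (zmem y x) (at level 70, no associativity).

Definition zsub (x y : zfset) : Prop := forall z, z ∈ x -> z ∈ y.
Notation "x ⊆ y" := (zsub x y) (at level 70, no associativity).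

(** The set of values of a family indexed by a small type. *)
Definition zrange (A : Type) (f : A -> zfset) : zfset :=
  \pi_zfset (Sup (fun a => repr (f a))).

Definition zempty : zfset := zrange (fun v : void => match v with end).

Definition zsep (P : zfset -> Prop) (x : zfset) : zfset :=
  zrange (fun i : {i : idx x | P (elt i)} => elt (proj1_sig i)).

Definition zimage (F : zfset -> zfset) (x : zfset) : zfset :=
  zrange (fun i : idx x => F (elt i)).

Definition zpair (x y : zfset) : zfset :=
  zrange (fun b : bool => if b then x else y).

Definition zcup (x : zfset) : zfset :=
  zrange (fun p : {i : idx x & idx (elt i)} => elt (projT2 p)).

Definition zpow (x : zfset) : zfset :=
  zrange (fun P : idx x -> Prop =>
    zrange (fun i : {i : idx x | P i} => elt (proj1_sig i))).

Definition zcap (x y : zfset) : zfset := zsep (fun z => z ∈ y) x.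

Definition opair (x y : zfset) : zfset := zpair (zpair x x) (zpair x y).

Lemma treq_pi x y : treq x y <-> \pi_zfset x = \pi_zfset y.
Proof. by split=> [xy|/eqmodP/asboolP//]; apply/eqmodP/asboolP. Qed.

Lemma treq_repr_pi x : treq (repr (\pi_zfset x)) x.
Proof. by apply/treq_pi; rewrite reprK. Qed.

Lemma mem_piSup A (f : A -> tree) y :
  y ∈ \pi_zfset (Sup f) <-> exists a, \pi_zfset (f a) = y.
Proof.
rewrite /zmem /elt /idx; move: (treq_repr_pi (Sup f)).
case: (repr _) => B g /= [gf fg]; split=> [[b <-]|[a <-]].
  by have [a /treq_pi] := gf b; exists a.
by have [b /treq_pi] := fg a; exists b.
Qed.

Lemma mem_zrange A (f : A -> zfset) y : y ∈ zrange f <-> exists a, f a = y.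
Proof.
by rewrite mem_piSup; split=> -[a]; rewrite ?reprK => <-; exists a; rewrite ?reprK.
Qed.

Lemma zext x y : (forall z, z ∈ x <-> z ∈ y) -> x = y.
Proof.
rewrite /zmem /elt /idx => xy; rewrite -[x]reprK -[y]reprK; apply/treq_pi.
move: xy; case: (repr x) (repr y) => A f [B g] /= fg; split=> [a|b].
  by have [//|b /esym/treq_pi] := (fg (\pi_zfset (f a))).1; [exists a|exists b].
by have [//|a /treq_pi] := (fg (\pi_zfset (g b))).2; [exists b|exists a].
Qed.

Lemma zmem_ind (P : zfset -> Prop) :
  (forall x, (forall y, y ∈ x -> P y) -> P x) -> forall x, P x.
Proof.
move=> IH x; rewrite -[x]reprK; elim: (repr x) => A f IHf.
by apply: IH => y /mem_piSup[a <-].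
Qed.

Lemma mem_zempty y : ~ y ∈ zempty.
Proof. by rewrite mem_zrange => -[[]]. Qed.

Lemma mem_zsep P x y : y ∈ zsep P x <-> y ∈ x /\ P y.
Proof.
rewrite mem_zrange; split=> [[[i Pi] <-]|[[i <-] Pi]]; first by split; [exists i|].
by exists (exist _ i Pi).
Qed.

Lemma mem_zimage F x y : y ∈ zimage F x <-> exists2 z, z ∈ x & F z = y.
Proof.
rewrite mem_zrange; split=> [[i <-]|[z [i <-] <-]]; last by exists i.
by exists (elt i) => //; exists i.
Qed.

Lemma mem_zpair x y z : z ∈ zpair x y <-> z = x \/ z = y.
Proof.
rewrite mem_zrange; split=> [[[] <-]|[->|->]]; [by left|by right|..].
  by exists true.
by exists false.
Qed.

Lemma mem_zcup x z : z ∈ zcup x <-> exists2 y, y ∈ x & z ∈ y.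
Proof.
rewrite mem_zrange; split=> [[[i k] <-]|[y [i <-] [k <-]]].
  by exists (elt i); [exists i|exists k].
by exists (existT _ i k).
Qed.

Lemma mem_zpow x z : z ∈ zpow x <-> z ⊆ x.
Proof.
rewrite mem_zrange; split=> [[P <-] y|zx].
  by rewrite mem_zrange => -[[i Pi] <-]; exists i.
exists (fun i => elt i ∈ z); apply: zext => y; rewrite mem_zrange.
split=> [[[i zi] <-]//|zy]; have [i eiy] := zx _ zy.
by rewrite -eiy in zy *; exists (exist _ i zy).
Qed.

Lemma mem_zcap x y z : z ∈ zcap x y <-> z ∈ x /\ z ∈ y.
Proof. exact: mem_zsep. Qed.

Lemma zsingle_inj x y : zpair x x = zpair y y -> x = y.
Proof.
move=> e; have : x ∈ zpair y y by rewrite -e; apply/mem_zpair; left.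
by case/mem_zpair.
Qed.

Lemma opair_inj x y x' y' : opair x y = opair x' y' -> x = x' /\ y = y'.
Proof.
have pairl a b c : zpair a b = zpair c c -> a = c /\ b = c.
  move=> e; have ha : a ∈ zpair c c by rewrite -e; apply/mem_zpair; left.
  have hb : b ∈ zpair c c by rewrite -e; apply/mem_zpair; right.
  by case/mem_zpair: ha; case/mem_zpair: hb.
have pairr a b c : zpair a b = zpair a c -> b = c.
  move=> e; have hb : b ∈ zpair a c by rewrite -e; apply/mem_zpair; right.
  have hc : c ∈ zpair a b by rewrite e; apply/mem_zpair; right.
  by case/mem_zpair: hb hc => // ->; case/mem_zpair.
move=> e; have xx' : x = x'.
  have : zpair x x ∈ opair x' y' by rewrite -e; apply/mem_zpair; left.
  by case/mem_zpair => [/zsingle_inj//|/esym/pairl[]].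
by subst x'; split=> //; apply: (pairr x); apply: (pairr (zpair x x)).
Qed.

(** * Ordinals and the cumulative hierarchy *)

(** Von Neumann ordinals; [∈] is well-founded by [zmem_ind], so only linearity
    needs to be required for [∈] to well-order [x]. *)
Definition ordinal_set (x : zfset) : Prop :=
  (forall y, y ∈ x -> y ⊆ x) /\
  (forall y z, y ∈ x -> z ∈ x -> y ∈ z \/ y = z \/ z ∈ y).

Definition zsucc (x : zfset) : zfset := zcup (zpair x (zpair x x)).

Definition limit_ordinal (x : zfset) : Prop :=
  [/\ ordinal_set x, x <> zempty &
      forall y, ordinal_set y -> x <> zsucc y].

(** [Vset α] is the union of the power sets of [Vset β] for [β ∈ α]; see
    [VsetE]. *)
Fixpoint Vtree (t : tree) : zfset :=
  match t with Sup A f => zcup (zrange (fun a => zpow (Vtree (f a)))) end.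

Definition Vset (x : zfset) : zfset := Vtree (repr x).

Lemma Vtree_treq s t : treq s t -> Vtree s = Vtree t.
Proof.
elim: s t => A f IH [B g] /= [fg gf]; congr zcup; apply: zext => y.
rewrite !mem_zrange; split=> [[a <-]|[b <-]].
  by have [b /IH e] := fg a; exists b; rewrite e.
by have [a /IH e] := gf b; exists a; rewrite e.
Qed.

Lemma VsetE x : Vset x = zcup (zimage (fun y => zpow (Vset y)) x).
Proof.
rewrite {1}/Vset /zimage /idx /elt; case: (repr x) => A f /=; congr zcup.
apply: zext => y; rewrite !mem_zrange.
by split=> -[a <-]; exists a; rewrite /Vset (Vtree_treq (treq_repr_pi _)).
Qed.

(** * First-order formulas of set theory and elementary embeddings *)

(** De Bruijn indices: [FAll] binds variable 0. *)
Inductive formula : Type :=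
  | FMem of nat & nat
  | FEq of nat & nat
  | FFalse
  | FImp of formula & formula
  | FAll of formula.

Definition scons (x : zfset) (e : nat -> zfset) (n : nat) : zfset :=
  if n is n'.+1 then e n' else x.

Fixpoint sat (M : zfset) (e : nat -> zfset) (phi : formula) : Prop :=
  match phi with
  | FMem m n => e m ∈ e n
  | FEq m n => e m = e n
  | FFalse => False
  | FImp p q => sat M e p -> sat M e q
  | FAll p => forall x, x ∈ M -> sat M (scons x e) p
  end.

Definition zfunction (f A B : zfset) : Prop :=
  (forall p, p ∈ f -> exists x y, [/\ x ∈ A, y ∈ B & p = opair x y]) /\
  (forall x, x ∈ A -> exists! y, opair x y ∈ f).

(** The value at [x] of a set function; [zempty] outside the domain. *)
Definition app (f x : zfset) : zfset :=
  xget zempty [set y | opair x y ∈ f].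

(** Parameters are given by assignments [e : nat -> zfset], of which a formula
    uses only finitely many values. *)
Definition elementary (M f : zfset) : Prop :=
  zfunction f M M /\
  forall phi e, (forall n, e n ∈ M) ->
    (sat M e phi <-> sat M (fun n => app f (e n)) phi).

(** Only elements of the domain of [j] can be moved. *)
Definition moved (j x : zfset) : Prop :=
  exists2 y, opair x y ∈ j & y <> x.

Definition Emb (lam : zfset) : set zfset :=
  [set j | elementary (Vset lam) j /\ exists x, moved j x].

(** The critical point: the least ordinal moved by [j]; [zempty] is a junk value
    for a [j] that moves no ordinal. *)
Definition cr (j : zfset) : zfset :=
  xget zempty [set k | [/\ ordinal_set k, moved j k &
                           forall b, b ∈ k -> ~ moved j b]].

(** The application [j · k], the union of [j (k ∩ V_α)] over [α < λ]. *)
Definition application (lam j k : zfset) : zfset :=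
  zcup (zimage (fun a => app j (zcap k (Vset a))) lam).

Inductive Aclosure (lam : zfset) (H : set zfset) : set zfset :=
  | Aclosure_gen h : H h -> Aclosure lam H h
  | Aclosure_app j k : Aclosure lam H j -> Aclosure lam H k ->
      Aclosure lam H (application lam j k).

(** For a set of ordinals, ordered by [∈]: it is order isomorphic to [nat]. *)
Definition has_order_type_omega (X : set zfset) : Prop :=
  exists e : nat -> zfset,
    range e = X /\ forall m n, (m < n)%N <-> e m ∈ e n.

(* Main.v *)
Require Import Defs.
From mathcomp Require Import all_boot.
From mathcomp Require Import boolp classical_sets functions cardinality.

Set Implicit Arguments.
Unset Strict Implicit.
Unset Printing Implicit Defensive.

Local Open Scope classical_set_scope.

(** Three facts carry the proof.

    Kunen's theorem: [j ∈ E_λ] fixes no ordinal [γ] with [cr j < γ < λ]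
    ([kunen], [kunen_cr]).  Choose [f : X^ω -> X] such that every injective image
    of [X] in itself carries an [ω]-sequence at which [f] takes any given value
    ([omega_jonsson]).  If [j(X) = X], then [j(f)] takes every value of [X] at
    some sequence in the range of [j]; as [j] fixes [ω] pointwise, that sequence
    is [j(s)] and the value is [j(f(s))], so [j] permutes [X].  It follows that
    the critical sequence of [j] is cofinal in [λ] ([crseq_cofinal]).  The sets
    [V_κ] for [κ] in that sequence form an elementary chain with union [V_λ],
    and this makes [j · k] elementary ([application_Emb]).

    The theorem of Laver and Steel ([no_infinite_descent]): for a limit [γ < λ]
    there is no infinite sequence [w_(n+1) = w_n · a_n] in which every [w_n]
    takes some [β_n < γ] to [γ] or above.  Write [trace U w] for the set of the
    pairs [(x, y) ∈ U] with [y ∈ w(x)].  The trace of [w_(n+1)] in [V_γ] is the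
    section of the trace of [w_n] at the trace of [a_n] in [V_(β_n)], an element
    of [V_γ].  So the sequence is a descent through iterated sections that starts
    from one relation, the trace of [w_0], with all the other data inside [V_γ].
    Since [γ <= w_0(β_0)], in [V_λ] the set [w_0(trace V_(β_0) a_0)] starts a
    descent, that of [w_1, w_2, ...], at some level [γ < w_0(β_0 + 1)].  By
    elementarity of [w_0], the trace of [a_0] starts a descent at some level
    [γ' < γ].  The step cannot be repeated at once, because the relations in the
    new descent need not be traces of embeddings.  What is needed of them is that
    they allow the step again: a relation is [good] if every descent that it
    starts, with good relations further down, is reflected to a lower level in
    the same manner.  This is a sound recursion.  It is definable in [V_λ], hence
    respected by embeddings, so traces of embeddings are good ([good_trace]);
    and a good relation starting a descent at an [∈]-minimal level is absurd
    ([no_descent]).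

    Finiteness ([all_finitely_traced]): the elements of [A_H] have finitely many
    traces in [V_γ] for each limit [γ < λ].  Let [γ] be the least exception.  Up
    to its trace in [V_γ], an element with critical point below [γ] is a product
    [h · a_1 · a_2 ⋯] from the left all of whose proper prefixes have critical
    point below [γ], because a left factor with critical point [>= γ] can be
    dropped; and only finitely many [h] occur.  By Kunen's theorem each prefix
    [w] takes some limit [β < γ] to [γ] or above ([stretch_below]), so the trace
    of [w · a] in [V_γ] depends only on those of [w] in [V_γ] and of [a] in
    [V_β], and the latter are finitely many.  So the tree of these products is
    finitely branching and infinite, and König's lemma produces the sequence
    that Laver and Steel exclude.

    The trace of [w] in [V_γ] determines [cr w] if [cr w < γ], so only finitely
    many critical points lie below each [θ < λ]; and there is no largest one,
    since [cr (k · k) = k(cr k) > cr k]. *)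

(** * Ordinals and levels of the cumulative hierarchy *)

Lemma zsub_refl x : x ⊆ x.
Proof. by []. Qed.
#[local] Hint Resolve zsub_refl : core.

Lemma zsub_antisym x y : x ⊆ y -> y ⊆ x -> x = y.
Proof. by move=> xy yx; apply: zext => z; split; [apply: xy|apply: yx]. Qed.

Lemma zmem_min (P : zfset -> Prop) x :
  P x -> exists2 m, P m & forall y, y ∈ m -> ~ P y.
Proof.
apply: contraPP => no; elim/zmem_ind: x => x IH Px.
by apply: no; exists x.
Qed.

Lemma zmem_irr x : ~ x ∈ x.
Proof. by elim/zmem_ind: x => x IH xx; apply: (IH x). Qed.

Lemma zmem_asym x y : x ∈ y -> ~ y ∈ x.
Proof. by elim/zmem_ind: x y => x IH y xy yx; apply: (IH y yx x). Qed.

Lemma mem_zsucc x y : y ∈ zsucc x <-> y ∈ x \/ y = x.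
Proof.
rewrite mem_zcup; split=> [[z /mem_zpair[->|->]]|[yx|->]].
- by left.
- by case/mem_zpair; right.
- by exists x => //; apply/mem_zpair; left.
- by exists (zpair x x); apply/mem_zpair; [right|left].
Qed.

Definition ztrans (x : zfset) : Prop := forall y, y ∈ x -> y ⊆ x.

Lemma ord_trans x : ordinal_set x -> ztrans x.
Proof. by case. Qed.

Lemma ord_mem x y : ordinal_set x -> y ∈ x -> ordinal_set y.
Proof.
move=> [tx lx] yx; split=> [z zy w wz|z w zy wy]; last first.
  by apply: lx; apply: tx yx _ _.
have zx := tx _ yx _ zy; have wx := tx _ zx _ wz.
have [//|[e|yw]] := lx _ _ wx yx; first by case: (zmem_asym zy); rewrite -e.
have [wz'|[e|zw]] := lx _ _ wx zx.
- have [yz|[e|zy']] := lx _ _ yx zx.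
  + by case: (zmem_asym yz).
  + by case: (@zmem_irr y); rewrite {1}e.
  + exfalso; move: zy wz yw; elim/zmem_ind: y z w {yx zx wx wz' zy'} => y IH z w.
    by move=> zy wz yw; apply: (IH z zy w y).
- by case: (@zmem_irr z); rewrite -{1}e.
- by case: (zmem_asym zw).
Qed.

Lemma ord_sub_mem x y : ordinal_set x -> ordinal_set y -> x ⊆ y ->
  x = y \/ x ∈ y.
Proof.
move=> ox oy xy; have [|nyx] := pselect (y ⊆ x).
  by move=> yx; left; apply: zsub_antisym.
right; have [m [my mx] mmin] : exists2 m, m ∈ y /\ ~ m ∈ x &
    forall z, z ∈ m -> ~ (z ∈ y /\ ~ z ∈ x).
  have [z /not_implyP[zy zx]] := (existsNP _).2 nyx.
  by apply: (@zmem_min (fun m => m ∈ y /\ ~ m ∈ x) z).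
suff -> : x = m by [].
apply: zsub_antisym => z.
  move=> zx; have zy := xy _ zx; case: oy => ty ly.
  have [//|[e|mz]] := ly _ _ zy my; first by case: mx; rewrite -e.
  by case: mx; apply: (ord_trans ox zx).
move=> zm; apply: contrapT => nzx; apply: (mmin z zm); split=> //.
exact: (ord_trans oy my).
Qed.

Lemma ord_zcap x y : ordinal_set x -> ordinal_set y -> ordinal_set (zcap x y).
Proof.
move=> [tx lx] [ty ly]; split=> [z /mem_zcap[zx zy] w wz|z w].
  by apply/mem_zcap; split; [apply: tx wz|apply: ty wz].
by move=> /mem_zcap[zx _] /mem_zcap[wx _]; apply: lx.
Qed.

Lemma ord_total x y : ordinal_set x -> ordinal_set y ->
  [\/ x ∈ y, x = y | y ∈ x].
Proof.
move=> ox oy; have oxy := ord_zcap ox oy.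
have sx : zcap x y ⊆ x by move=> z /mem_zcap[].
have sy : zcap x y ⊆ y by move=> z /mem_zcap[].
case: (ord_sub_mem oxy ox sx) => [ex|mx].
  have xy : x ⊆ y by rewrite -ex.
  by case: (ord_sub_mem ox oy xy) => [->|]; [apply: Or32|apply: Or31].
case: (ord_sub_mem oxy oy sy) => [ey|my].
  have yx : y ⊆ x by rewrite -ey.
  by case: (ord_sub_mem oy ox yx) => [->|]; [apply: Or32|apply: Or33].
by case: (@zmem_irr (zcap x y)); apply/mem_zcap.
Qed.

Lemma ord_subP x y : ordinal_set x -> ordinal_set y ->
  x ⊆ y <-> ~ y ∈ x.
Proof.
move=> ox oy; split=> [xy yx|nyx]; first exact: (@zmem_irr y (xy _ yx)).
by case: (ord_total ox oy) => [/(ord_trans oy)|->|].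
Qed.

Lemma ord_memVsub x y : ordinal_set x -> ordinal_set y -> x ∈ y \/ y ⊆ x.
Proof.
move=> ox oy; case: (pselect (x ∈ y)) => [|n]; [by left|right].
exact/ord_subP.
Qed.

Lemma ord_le_lt x y z : ordinal_set x -> ordinal_set y -> ordinal_set z ->
  x ⊆ y -> y ∈ z -> x ∈ z.
Proof.
move=> ox oy oz xy yz; case: (ord_sub_mem ox oy xy) => [->//|].
exact: (ord_trans oz yz).
Qed.

Lemma ord_succ x : ordinal_set x -> ordinal_set (zsucc x).
Proof.
move=> [tx lx]; split=> [y /mem_zsucc yx z zy|y z /mem_zsucc yx /mem_zsucc zx].
  apply/mem_zsucc; left; case: yx zy => [yx|->//]; exact: tx.
case: yx zx => [yx|->] [zx|->]; [exact: lx|by left|by right; right|].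
by right; left.
Qed.

Definition lim (x : zfset) : Prop :=
  [/\ ordinal_set x, zempty ∈ x & forall y, y ∈ x -> zsucc y ∈ x].

Lemma lim_ord x : lim x -> ordinal_set x.
Proof. by case. Qed.
#[local] Hint Resolve lim_ord : core.

Lemma ord_empty : ordinal_set zempty.
Proof. by split=> [y|y z] /mem_zempty. Qed.

Lemma sub_empty x : zempty ⊆ x.
Proof. by move=> z /mem_zempty. Qed.

Lemma succ_sub x y : ordinal_set y -> x ∈ y -> zsucc x ⊆ y.
Proof. by move=> oy xy z /mem_zsucc[|->//]; apply: (ord_trans oy). Qed.

Lemma limP x : limit_ordinal x -> lim x.
Proof.
case=> ox x0 xs; split=> // [|y yx].
  by case: (ord_sub_mem ord_empty ox (@sub_empty x)) => // e; case: x0.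
have oy := ord_mem ox yx.
case: (ord_sub_mem (ord_succ oy) ox (succ_sub ox yx)) => // e.
by case: (xs y oy).
Qed.

Lemma mem_Vset x y : y ∈ Vset x <-> exists2 z, z ∈ x & y ⊆ Vset z.
Proof.
rewrite VsetE mem_zcup; split=> [[w /mem_zimage[z zx <-] /mem_zpow]|[z zx yz]].
  by exists z.
by exists (zpow (Vset z)); [apply/mem_zimage; exists z|apply/mem_zpow].
Qed.

Lemma Vset_trans x : ztrans (Vset x).
Proof.
elim/zmem_ind: x => x IH y /mem_Vset[z zx yz] w /yz wz.
by apply/mem_Vset; exists z => //; apply: IH.
Qed.

Lemma Vset_down x y z : y ∈ Vset x -> z ⊆ y -> z ∈ Vset x.
Proof.
move=> /mem_Vset[w wx yw] zy; apply/mem_Vset; exists w => // u /zy; exact: yw.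
Qed.

Lemma Vset_mem x y : x ∈ y -> Vset x ∈ Vset y.
Proof. by move=> xy; apply/mem_Vset; exists x. Qed.

Lemma Vset_mono x y : x ⊆ y -> Vset x ⊆ Vset y.
Proof.
by move=> xy z /mem_Vset[w wx zw]; apply/mem_Vset; exists w => //; apply: xy.
Qed.

Lemma sub_Vset x : x ⊆ Vset x.
Proof.
by elim/zmem_ind: x => x IH y yx; apply/mem_Vset; exists y => //; apply: IH.
Qed.

(** [V_a] contains no ordinals besides the elements of [a], so membership in
    [V_λ] bounds an ordinal by [λ]. *)
Lemma ord_Vset x a : ordinal_set a -> ordinal_set x -> x ∈ Vset a -> x ∈ a.
Proof.
elim/zmem_ind: a x => a IH x oa ox /mem_Vset[b ba xb].
have ob := ord_mem oa ba.
apply: (ord_le_lt ox ob oa _ ba) => y yx.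
by apply: (IH b ba y ob); [exact: (ord_mem ox yx)|exact: xb].
Qed.

Lemma lim_Vset_ex x y : lim x -> y ∈ Vset x ->
  exists2 b, b ∈ x & y ∈ Vset b.
Proof.
case=> ox _ sx /mem_Vset[z zx yz]; exists (zsucc z); first exact: sx.
by apply/mem_Vset; exists z => //; apply/mem_zsucc; right.
Qed.

Lemma ord_max2 x a b : ordinal_set x -> a ∈ x -> b ∈ x ->
  exists2 c, c ∈ x & a ⊆ c /\ b ⊆ c.
Proof.
move=> ox ax bx; have oa := ord_mem ox ax; have ob := ord_mem ox bx.
case: (ord_memVsub oa ob) => h; last by exists a.
by exists b => //; split=> //; apply: (ord_trans ob).
Qed.

Lemma lim_zpair x y z : lim x -> y ∈ Vset x -> z ∈ Vset x ->
  zpair y z ∈ Vset x.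
Proof.
move=> lx; case: (lx) => ox _ _ /(lim_Vset_ex lx)[b bx yb] /(lim_Vset_ex lx)[c cx zc].
have [d dx [bd cd]] := ord_max2 ox bx cx.
apply/mem_Vset; exists d => // w /mem_zpair[] ->.
  exact: (Vset_mono bd).
exact: (Vset_mono cd).
Qed.

Lemma lim_opair x y z : lim x -> y ∈ Vset x -> z ∈ Vset x ->
  opair y z ∈ Vset x.
Proof. by move=> lx yx zx; do !apply: lim_zpair. Qed.

Lemma lim_pow x y : lim x -> y ∈ Vset x -> zpow y ∈ Vset x.
Proof.
move=> lx; case: (lx) => ox _ sx /mem_Vset[b bx yb].
apply/mem_Vset; exists (zsucc b); first exact: sx.
move=> z /mem_zpow zy; apply/mem_Vset; exists b; first by apply/mem_zsucc; right.
by move=> w /zy; apply: yb.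
Qed.

Lemma lim_succ x y : lim x -> y ∈ Vset x -> zsucc y ∈ Vset x.
Proof.
move=> lx; case: (lx) => ox _ sx /mem_Vset[b bx yb].
apply/mem_Vset; exists (zsucc b); first exact: sx.
move=> z /mem_zsucc[zy|->]; last by apply/mem_Vset; exists b; rewrite ?mem_zsucc; [right|].
apply: (@Vset_mono b); last exact: yb.
by move=> w wb; apply/mem_zsucc; left.
Qed.

Lemma pair_meml x y u : ztrans u -> opair x y ∈ u -> x ∈ u.
Proof.
move=> tu pu; have pxx : zpair x x ∈ u by apply: (tu _ pu); apply/mem_zpair; left.
by apply: (tu _ pxx); apply/mem_zpair; left.
Qed.

Lemma pair_memr x y u : ztrans u -> opair x y ∈ u -> y ∈ u.
Proof.
move=> tu pu; have pxx : zpair x y ∈ u by apply: (tu _ pu); apply/mem_zpair; right.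
by apply: (tu _ pxx); apply/mem_zpair; right.
Qed.

Fixpoint vn (n : nat) : zfset := if n is m.+1 then zsucc (vn m) else zempty.

Definition omega : zfset := zrange vn.

Lemma mem_omega x : x ∈ omega <-> exists n, vn n = x.
Proof. exact: mem_zrange. Qed.

Lemma vn_mem n x : x ∈ vn n -> exists m, vn m = x.
Proof.
elim: n => [/mem_zempty//|n IH] /= /mem_zsucc[|->]; first exact: IH.
by exists n.
Qed.

Lemma vn_lt m n : (m < n)%N -> vn m ∈ vn n.
Proof.
elim: n => // n IH; rewrite ltnS leq_eqVlt => /orP[/eqP->|/IH mn] /=.
  by apply/mem_zsucc; right.
by apply/mem_zsucc; left.
Qed.

Lemma vn_inj : injective vn.
Proof.
move=> m n e; case: (ltngtP m n) => // /vn_lt; rewrite e; by move/zmem_irr.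
Qed.

Lemma ord_omega : ordinal_set omega.
Proof.
split=> [x /mem_omega[n <-] y /vn_mem[m <-]|x y].
  by apply/mem_omega; exists m.
move=> /mem_omega[m <-] /mem_omega[n <-].
case: (ltngtP m n) => [/vn_lt|/vn_lt|->]; [by left|by right; right|].
by right; left.
Qed.

Lemma omega_sub_lim x : lim x -> omega ⊆ x.
Proof. by case=> _ x0 sx _ /mem_omega[n <-]; elim: n => //= n; apply: sx. Qed.

Lemma lim_omega : lim omega.
Proof.
split=> [||_ /mem_omega[n <-]]; first exact: ord_omega.
  by apply/mem_omega; exists 0.
by apply/mem_omega; exists n.+1.
Qed.

(** * Definable predicates and elementary embeddings *)

Section Definability.
Variable lam : zfset.
Hypothesis hlam : lim lam.
Local Notation M := (Vset lam).

(** Each predicate below is shown definable for arbitrary positions of its arguments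
    in [e], which spares substitution in formulas. *)
Definition definable (P : (nat -> zfset) -> Prop) : Prop :=
  exists phi, forall e, (forall n, e n ∈ M) -> (sat M e phi <-> P e).

Lemma definable_ext P Q : definable Q -> (forall e, (forall n, e n ∈ M) -> (P e <-> Q e)) ->
  definable P.
Proof. by move=> [phi H] PQ; exists phi => e eM; rewrite H // PQ. Qed.

Lemma definable_mem i k : definable (fun e => e i ∈ e k).
Proof. by exists (FMem i k). Qed.

Lemma definable_eq i k : definable (fun e => e i = e k).
Proof. by exists (FEq i k). Qed.

Lemma definable_imp P Q : definable P -> definable Q -> definable (fun e => P e -> Q e).
Proof.
move=> [p hp] [q hq]; exists (FImp p q) => e eM /=.
by rewrite hp // hq.
Qed.

Lemma definable_false : definable (fun=> False).
Proof. by exists FFalse. Qed.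

Lemma definable_not P : definable P -> definable (fun e => ~ P e).
Proof. by move=> p; apply: definable_imp => //; apply: definable_false. Qed.

Lemma definable_and P Q : definable P -> definable Q -> definable (fun e => P e /\ Q e).
Proof.
move=> p q; apply: (definable_ext (definable_not (definable_imp p (definable_not q)))) => e _.
split=> [[? ?]|]; first exact.
by move=> /not_implyP[? /contrapT].
Qed.

Lemma definable_or P Q : definable P -> definable Q -> definable (fun e => P e \/ Q e).
Proof.
move=> p q; apply: (definable_ext (definable_imp (definable_not p) q)) => e _.
split=> [[]//|]; by case: (pselect (P e)) => ?; [left|right; auto].
Qed.

Lemma definable_iff P Q : definable P -> definable Q -> definable (fun e => P e <-> Q e).
Proof. by move=> p q; apply: definable_and; apply: definable_imp. Qed.

Lemma scons_eta (e : nat -> zfset) : e = scons (e 0) (fun n => e n.+1).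
Proof. by apply: funext; case. Qed.

Lemma sconsM x e : x ∈ M -> (forall n, e n ∈ M) -> forall n, scons x e n ∈ M.
Proof. by move=> xM eM []. Qed.

Lemma definable_all (P : zfset -> (nat -> zfset) -> Prop) :
  definable (fun e => P (e 0) (fun n => e n.+1)) ->
  definable (fun e => forall x, x ∈ M -> P x e).
Proof.
move=> [p hp]; exists (FAll p) => e eM /=.
by split=> H x xM; have := H x xM; rewrite hp //; apply: sconsM.
Qed.

Lemma definable_ex (P : zfset -> (nat -> zfset) -> Prop) :
  definable (fun e => P (e 0) (fun n => e n.+1)) ->
  definable (fun e => exists2 x, x ∈ M & P x e).
Proof.
move=> p; apply: (definable_ext (definable_not (definable_all (P := fun x e => ~ P x e) _))).
  exact: definable_not.
move=> e _; split=> [[x xM Px] H|]; first exact: (H x xM).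
by move=> /existsNP[x /not_implyP[xM /contrapT Px]]; exists x.
Qed.

Lemma definable_ball i (P : zfset -> (nat -> zfset) -> Prop) :
  definable (fun e => P (e 0) (fun n => e n.+1)) ->
  definable (fun e => forall x, x ∈ e i -> P x e).
Proof.
move=> p; apply: (definable_ext (definable_all (P := fun x e => x ∈ e i -> P x e) _)).
  by apply: definable_imp => //; apply: definable_mem.
move=> e eM; split=> H x; [by move=> _; apply: H|move=> xi].
by apply: H => //; apply: (Vset_trans (eM i)).
Qed.

Lemma definable_bex i (P : zfset -> (nat -> zfset) -> Prop) :
  definable (fun e => P (e 0) (fun n => e n.+1)) ->
  definable (fun e => exists2 x, x ∈ e i & P x e).
Proof.
move=> p; apply: (definable_ext (definable_ex (P := fun x e => x ∈ e i /\ P x e) _)).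
  by apply: definable_and => //; apply: definable_mem.
move=> e eM; split=> [[x xi Px]|[x xM [xi Px]]]; last by exists x.
by exists x => //; apply: (Vset_trans (eM i)).
Qed.

End Definability.

Ltac definable_step := first
  [ apply: definable_mem | apply: definable_eq | apply: definable_all | apply: definable_ex
  | apply: definable_ball | apply: definable_bex | apply: definable_not | apply: definable_and
  | apply: definable_or | apply: definable_iff | apply: definable_imp ]; cbv beta.
Ltac solve_definable := do ?[assumption | definable_step].

Section Predicates.
Variable lam : zfset.
Hypothesis hlam : lim lam.
Local Notation M := (Vset lam).
Local Notation definable := (definable lam).

Lemma sub_definable i k : definable (fun e => e i ⊆ e k).
Proof. by rewrite /zsub; solve_definable. Qed.

Lemma empty_definable i : definable (fun e => e i = zempty).
Proof.
apply: (@definable_ext _ _ (fun e => forall x, x ∈ e i -> ~ x = x)); first by solve_definable.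
move=> e _; split=> [-> x /mem_zempty//|H].
by apply: zext => z; split=> [/H|/mem_zempty].
Qed.

Lemma eq_zpairP z x y : z = zpair x y <->
  (forall u, u ∈ z -> u = x \/ u = y) /\ (x ∈ z /\ y ∈ z).
Proof.
split=> [->|[H [xz yz]]]; first by split; [move=> u /mem_zpair|rewrite !mem_zpair; auto].
by apply: zext => u; rewrite mem_zpair; split=> [/H//|[]->].
Qed.

Lemma zpair_definable i k l : definable (fun e => e i = zpair (e k) (e l)).
Proof.
pose P e := (forall u, u ∈ e i -> u = e k \/ u = e l) /\ (e k ∈ e i /\ e l ∈ e i).
apply: (@definable_ext _ _ P); first by rewrite /P; solve_definable.
by move=> e _; apply: eq_zpairP.
Qed.

Lemma opair_definable i k l : definable (fun e => e i = opair (e k) (e l)).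
Proof.
pose P e := (forall u, u ∈ e i -> u = zpair (e k) (e k) \/ u = zpair (e k) (e l)) /\
  ((exists2 u, u ∈ e i & u = zpair (e k) (e k)) /\
   (exists2 u, u ∈ e i & u = zpair (e k) (e l))).
apply: (@definable_ext _ _ P).
  rewrite /P; apply: definable_and; last apply: definable_and.
  - by apply: definable_ball; apply: definable_or; apply: (@zpair_definable 0).
  - by apply: definable_bex; apply: (@zpair_definable 0).
  - by apply: definable_bex; apply: (@zpair_definable 0).
move=> e _; rewrite /P; split=> [/eq_zpairP[H [H1 H2]]|].
  by split=> //; split; [exists (zpair (e k) (e k))|exists (zpair (e k) (e l))].
move=> [H [[u ui eu] [v vi ev]]]; apply/eq_zpairP; split=> //.
by rewrite -eu -ev.
Qed.

Definition prel (f x y : zfset) : Prop := opair x y ∈ f.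

Lemma prel_definable i k l : definable (fun e => prel (e i) (e k) (e l)).
Proof.
apply: (@definable_ext _ _ (fun e => exists2 p, p ∈ e i & p = opair (e k) (e l))).
  by apply: definable_bex; apply: (@opair_definable 0).
by move=> e _; rewrite /prel; split=> [H|[p pi <-]//]; exists (opair (e k) (e l)).
Qed.

Lemma succ_definable i k : definable (fun e => e i = zsucc (e k)).
Proof.
pose P e := (e k ⊆ e i /\ e k ∈ e i) /\ (forall x, x ∈ e i -> x ∈ e k \/ x = e k).
apply: (@definable_ext _ _ P); first by rewrite /P /zsub; solve_definable.
move=> e _; rewrite /P; split=> [->|[[H1 H2] H3]].
  by split; [split=> [x xk|]; apply/mem_zsucc; auto|move=> x /mem_zsucc].
by apply: zext => x; rewrite mem_zsucc; split=> [/H3//|[/H1|->]].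
Qed.

Lemma pow_definable i k : definable (fun e => e i = zpow (e k)).
Proof.
apply: (@definable_ext _ _ (fun e => forall x, x ∈ M -> (x ∈ e i <-> x ⊆ e k))).
  by rewrite /zsub; solve_definable.
move=> e eM; split=> [-> x _|H]; first exact: mem_zpow.
apply: zext => x; rewrite mem_zpow; split=> hx.
  by apply/H => //; apply: (Vset_trans (eM i)).
by apply/H => //; apply: (Vset_down (eM k)).
Qed.

Lemma cap_definable i k l : definable (fun e => e i = zcap (e k) (e l)).
Proof.
pose P e := (forall x, x ∈ e i -> x ∈ e k /\ x ∈ e l) /\
  (forall x, x ∈ e k -> x ∈ e l -> x ∈ e i).
apply: (@definable_ext _ _ P); first by rewrite /P; solve_definable.
move=> e _; rewrite /P; split=> [->|[H1 H2]].
  by split=> [x /mem_zcap|x xk xl]; last apply/mem_zcap.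
by apply: zext => x; rewrite mem_zcap; split=> [/H1//|[]]; apply: H2.
Qed.

Lemma ord_definable i : definable (fun e => ordinal_set (e i)).
Proof.
pose P e := (forall y, y ∈ e i -> y ⊆ e i) /\
  (forall y, y ∈ e i -> forall z, z ∈ e i -> y ∈ z \/ y = z \/ z ∈ y).
apply: (@definable_ext _ _ P); first by rewrite /P /zsub; solve_definable.
move=> e _; rewrite /P /ordinal_set.
split=> -[H1 H2]; split=> //; first by move=> y yi z zi; apply: H2.
by move=> y z yi zi; apply: H2.
Qed.

Lemma trans_definable i : definable (fun e => ztrans (e i)).
Proof. by rewrite /ztrans /zsub; solve_definable. Qed.

Lemma lim_definable i : definable (fun e => lim (e i)).
Proof.
pose P e := ordinal_set (e i) /\ ((exists2 x, x ∈ e i & x = zempty) /\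
  (forall y, y ∈ e i -> exists2 x, x ∈ e i & x = zsucc y)).
apply: (@definable_ext _ _ P).
  rewrite /P; apply: definable_and; first exact: ord_definable.
  apply: definable_and; first by apply: definable_bex; apply: (@empty_definable 0).
  by apply: definable_ball; apply: definable_bex; apply: (@succ_definable 0 1).
move=> e _; rewrite /P; split=> [[H1 H2 H3]|[H1 [[x xi x0] H2]]].
  split=> //; split; first by exists zempty.
  by move=> y /H3 ?; exists (zsucc y).
split=> // [|y /H2[z zi <-]//]; by rewrite -x0.
Qed.

Lemma omega_definable i : definable (fun e => e i = omega).
Proof.
pose P e := lim (e i) /\ (forall y, y ∈ e i -> y = zempty \/
  exists2 x, x ∈ e i & y = zsucc x).
apply: (@definable_ext _ _ P).
  rewrite /P; apply: definable_and; first exact: lim_definable.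
  apply: definable_ball; apply: definable_or; first exact: (@empty_definable 0).
  by apply: definable_bex; apply: (@succ_definable 1 0).
move=> e _; rewrite /P; split=> [->|[H1 H2]].
  split=> [|_ /mem_omega[[|n] <-]]; [exact: lim_omega|by left|right].
  by exists (vn n) => //; apply/mem_omega; exists n.
apply: zsub_antisym; last exact: omega_sub_lim.
move=> y; elim/zmem_ind: y => y IH /H2[->|[x xi yx]].
  by apply/mem_omega; exists 0.
have /mem_omega[n nx] : x ∈ omega.
  by apply: IH xi; rewrite yx; apply/mem_zsucc; right.
by apply/mem_omega; exists n.+1; rewrite yx -nx.
Qed.

(** A set of pairs [(b, V_b)] with a transitive domain witnesses [v = V_a]. *)
Definition Vhist (h : zfset) : Prop :=
  forall p, p ∈ h -> forall b, b ∈ M -> forall v, v ∈ M -> p = opair b v ->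
   (forall d, d ∈ b -> exists2 u, u ∈ M & prel h d u) /\
   (forall x, x ∈ M -> (x ∈ v <-> exists2 d, d ∈ b &
       exists2 u, u ∈ M & prel h d u /\ x ⊆ u)).

Lemma VsetM a : a ∈ lam -> Vset a ∈ M.
Proof. exact: Vset_mem. Qed.

Lemma VhistE h b v : Vhist h -> h ∈ M -> prel h b v -> v = Vset b.
Proof.
move=> Hh hM; elim/zmem_ind: b v => b IH v bv.
have tM := @Vset_trans lam; have pM := tM _ hM _ bv.
have bM := pair_meml tM pM; have vM := pair_memr tM pM.
have [H1 H2] := Hh _ bv _ bM _ vM erefl.
apply: zext => x; rewrite mem_Vset; split=> [xv|[d db xd]].
  have [d db [u uM [du xu]]] := (H2 x (tM _ vM _ xv)).1 xv.
  by exists d => //; rewrite -(IH _ db _ du).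
have [u uM du] := H1 _ db.
rewrite -(IH _ db _ du) in xd.
by apply/(H2 x (Vset_down uM xd)); exists d => //; exists u.
Qed.

Lemma Vhist_ex a : a ∈ lam -> exists2 h, h ∈ M & Vhist h /\ prel h a (Vset a).
Proof.
move=> al; have oa := ord_mem (lim_ord hlam) al.
have aM : a ∈ M by exact: sub_Vset.
exists (zimage (fun b => opair b (Vset b)) (zsucc a)).
  case: (hlam) => ol _ sl.
  have [b bl [ab aab]] : exists2 b, b ∈ lam & Vset (zsucc a) ⊆ Vset b /\
     forall c, c ∈ zsucc a -> opair c (Vset c) ∈ Vset b.
    exists (zsucc (zsucc (zsucc a))); first exact: (sl _ (sl _ (sl _ al))).
    split.
      by apply: Vset_mono => x xa; apply/mem_zsucc; left; apply/mem_zsucc; left.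
    move=> c ca.
    have ca' : c ∈ Vset (zsucc a) by apply: sub_Vset.
    have Vca' : Vset c ∈ Vset (zsucc a) by apply: Vset_mem.
    have P x y z : x ∈ Vset z -> y ∈ Vset z -> zpair x y ∈ Vset (zsucc z).
      move=> xz yz; apply/mem_Vset; exists z; first by apply/mem_zsucc; right.
      by move=> w /mem_zpair[]->.
    by apply: (P); apply: (P).
  apply/mem_Vset; exists b => // p /mem_zimage[c ca <-]; exact: aab.
split; last by apply/mem_zimage; exists a => //; apply/mem_zsucc; right.
move=> _ /mem_zimage[c ca <-] b bM v vM /opair_inj[<- <-] {b v bM vM}.
have oc : ordinal_set c by apply: (ord_mem _ ca); exact: ord_succ.
have H d : d ∈ c -> prel (zimage (fun b => opair b (Vset b)) (zsucc a)) d (Vset d).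
  move=> dc; apply/mem_zimage; exists d => //.
  by apply: (ord_trans (ord_succ oa)) dc.
have dl d : d ∈ c -> d ∈ lam.
  move=> dc; case: (hlam) => ol _ sl.
  exact: (ord_trans ol (sl _ al) (ord_trans (ord_succ oa) ca dc)).
split=> [d dc|x xM]; first by exists (Vset d); [exact/VsetM/dl|exact: H].
rewrite mem_Vset; split=> -[d dc]; last first.
  move=> [u _ [/mem_zimage[d' _ /opair_inj[ed <-]] xu]]; exists d' => //.
  by rewrite ed.
by move=> xd; exists d => //; exists (Vset d); [exact/VsetM/dl|split=> //; exact: H].
Qed.

(** The graph of [α ↦ V_α] is definable, so embeddings map [V_α] to [V_{j(α)}]. *)
Lemma isV_definable i k : definable (fun e => ordinal_set (e k) /\ e i = Vset (e k)).
Proof.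
pose P e := ordinal_set (e k) /\ exists2 h, h ∈ M & Vhist h /\ prel h (e k) (e i).
apply: (@definable_ext _ _ P).
  rewrite /P; apply: definable_and; first exact: ord_definable.
  apply: definable_ex; apply: definable_and; last exact: (@prel_definable 0).
  rewrite /Vhist; apply: definable_ball; do 2 apply: definable_all.
  apply: definable_imp; first exact: (@opair_definable 2 1 0).
  apply: definable_and.
    by apply: definable_ball; apply: definable_ex; apply: (@prel_definable 5 1 0).
  apply: definable_all; apply: definable_iff; first by solve_definable.
  apply: definable_bex; apply: definable_ex; apply: definable_and; first exact: (@prel_definable 6 1 0).
  exact: (@sub_definable 2 0).
move=> e eM; rewrite /P; split=> -[ok]; last by move=> [h hM [/VhistE]]; auto.
by move=> ->; split=> //; apply: Vhist_ex; apply: (ord_Vset (lim_ord hlam) ok).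
Qed.

End Predicates.

(** * Elementary embeddings of [V_λ] and their critical points *)

Section Elementary.
Variable lam : zfset.
Hypothesis hlam : lim lam.
Local Notation M := (Vset lam).
Local Notation definable := (definable lam).

Lemma lam_M a : a ∈ lam -> a ∈ M.
Proof. exact: sub_Vset. Qed.

Lemma lam_ord a : a ∈ lam -> ordinal_set a.
Proof. exact: ord_mem (lim_ord hlam). Qed.

Lemma M_lam a : ordinal_set a -> a ∈ M -> a ∈ lam.
Proof. exact: ord_Vset (lim_ord hlam). Qed.

Lemma memM x y : x ∈ y -> y ∈ M -> x ∈ M.
Proof. by move=> xy /Vset_trans; apply. Qed.

Lemma prelM f x y : f ∈ M -> prel f x y -> x ∈ M /\ y ∈ M.
Proof.
move=> fM fxy; have pM := memM fxy fM.
by split; [apply: pair_meml pM|apply: pair_memr pM]; apply: Vset_trans.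
Qed.

Section OneEmbedding.
Variable j : zfset.
Hypothesis ej : elementary M j.
Local Notation "'J' x" := (app j x) (at level 9, x at level 8).

Lemma app_graph x : x ∈ M -> prel j x (J x).
Proof.
move=> xM; rewrite /app; apply: (@xgetPex _ zempty [set y | opair x y ∈ j]).
by have [y [xy _]] := ej.1.2 _ xM; exists y.
Qed.

Lemma graph_dom x y : prel j x y -> x ∈ M /\ y ∈ M.
Proof. by move=> /(ej.1.1)[a [b [aM bM /opair_inj[-> ->]]]]. Qed.

Lemma graph_app x y : prel j x y -> y = J x.
Proof.
move=> xy; have [xM _] := graph_dom xy; have [z [_ uz]] := ej.1.2 _ xM.
by rewrite -(uz _ xy) -(uz _ (app_graph xM)).
Qed.

Lemma appM x : x ∈ M -> J x ∈ M.
Proof. by move=> /app_graph/graph_dom[]. Qed.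

Lemma graphP x y : prel j x y <-> x ∈ M /\ y = J x.
Proof.
split=> [H|[xM ->]]; last exact: app_graph.
by split; [case: (graph_dom H)|exact: graph_app].
Qed.

Lemma movedP x : moved j x <-> x ∈ M /\ J x <> x.
Proof.
split=> [[y /graphP[xM ->]]//|[xM n]]; by exists (J x) => //; apply: app_graph.
Qed.

Lemma elem P e : definable P -> (forall n, e n ∈ M) -> (P e <-> P (fun n => J (e n))).
Proof.
move=> [phi H] eM; rewrite -H // -H; first exact: ej.2.
by move=> n; apply: appM.
Qed.

Lemma elem1 (P : zfset -> Prop) x : x ∈ M -> definable (fun e => P (e 0)) ->
  (P x <-> P (J x)).
Proof. by move=> xM h; apply: (elem (e := fun=> x) h). Qed.

Lemma elem2 (P : zfset -> zfset -> Prop) x y : x ∈ M -> y ∈ M ->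
  definable (fun e => P (e 0) (e 1)) -> (P x y <-> P (J x) (J y)).
Proof.
move=> xM yM h; apply: (elem (e := scons x (fun=> y)) h); exact: sconsM.
Qed.

Lemma elem3 (P : zfset -> zfset -> zfset -> Prop) x y z :
  x ∈ M -> y ∈ M -> z ∈ M ->
  definable (fun e => P (e 0) (e 1) (e 2)) -> (P x y z <-> P (J x) (J y) (J z)).
Proof.
move=> xM yM zM h; apply: (elem (e := scons x (scons y (fun=> z))) h).
by do 2 apply: sconsM => //.
Qed.

Lemma app_mem x y : x ∈ M -> y ∈ M -> (x ∈ y <-> J x ∈ J y).
Proof. by move=> xM yM; apply: (elem2 (P := zmem)) => //; apply: definable_mem. Qed.

Lemma app_inj x y : x ∈ M -> y ∈ M -> J x = J y -> x = y.
Proof.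
by move=> xM yM; apply: (proj2 (elem2 (P := fun x y => x = y) _ _ (definable_eq _ 0 1))).
Qed.

Lemma app_sub x y : x ∈ M -> y ∈ M -> (x ⊆ y <-> J x ⊆ J y).
Proof. by move=> xM yM; apply: (elem2 (P := zsub)) => //; apply: sub_definable. Qed.

Lemma app_prel f x y : f ∈ M -> x ∈ M -> y ∈ M ->
  (prel f x y <-> prel (J f) (J x) (J y)).
Proof.
by move=> fM xM yM; apply: (elem3 (P := prel)) => //; apply: (@prel_definable _ 0 1 2).
Qed.

Lemma app_empty : J zempty = zempty.
Proof.
have M0 : zempty ∈ M by case: (hlam) => _ /lam_M.
by apply: (proj1 (elem1 (P := fun x => x = zempty) _ _)) => //; apply: empty_definable.
Qed.

Lemma app_succ x : x ∈ M -> J (zsucc x) = zsucc (J x).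
Proof.
move=> xM; apply: (proj1 (elem2 (P := fun y x => y = zsucc x) _ _ _)) => //.
  exact: lim_succ.
exact: (@succ_definable _ 0 1).
Qed.

Lemma app_pow x : x ∈ M -> J (zpow x) = zpow (J x).
Proof.
move=> xM; apply: (proj1 (elem2 (P := fun y x => y = zpow x) _ _ _)) => //.
  exact: lim_pow.
exact: (@pow_definable _ 0 1).
Qed.

Lemma app_trans x : x ∈ M -> ztrans x -> ztrans (J x).
Proof.
by move=> xM tx; apply: (proj1 (elem1 (P := ztrans) _ _)) => //; apply: (@trans_definable _ 0).
Qed.

Lemma app_lim x : x ∈ M -> lim x -> lim (J x).
Proof.
by move=> xM lx; apply: (proj1 (elem1 (P := lim) _ _)) => //; apply: (@lim_definable _ 0).
Qed.

Lemma app_lam a : a ∈ lam -> J a ∈ lam.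
Proof.
move=> al; have aM := lam_M al; apply: M_lam; last exact: appM.
by apply: (proj1 (elem1 (P := ordinal_set) _ _)); [|exact: ord_definable|exact: lam_ord].
Qed.

Lemma app_ord a : a ∈ lam -> ordinal_set (J a).
Proof. by move=> /app_lam/lam_ord. Qed.

Lemma app_Vset a : a ∈ lam -> J (Vset a) = Vset (J a).
Proof.
move=> al; have aM := lam_M al; have vM := VsetM al.
have [+ _] := elem2 (P := fun v a => ordinal_set a /\ v = Vset a) vM aM
  (isV_definable hlam 0 1).
by case=> //; split=> //; apply: lam_ord.
Qed.

Lemma app_vn n : vn n ∈ M -> J (vn n) = vn n.
Proof.
elim: n => [|n IH] /= nM; first exact: app_empty.
have nM' : vn n ∈ M by apply: memM nM; apply/mem_zsucc; right.
by rewrite app_succ ?IH.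
Qed.

Lemma vnM n : vn n ∈ M.
Proof. by apply: lam_M; apply: (omega_sub_lim hlam); apply/mem_omega; exists n. Qed.

Lemma app_omega : omega ∈ M -> J omega = omega.
Proof.
by move=> oM; apply: (proj1 (elem1 (P := fun x => x = omega) _ _)) => //; apply: omega_definable.
Qed.

Lemma app_ge a : a ∈ lam -> a ⊆ J a.
Proof.
move=> al; apply: contrapT => n.
have [m [ml mJ] mmin] : exists2 m, m ∈ lam /\ J m ∈ m &
    forall y, y ∈ m -> ~ (y ∈ lam /\ J y ∈ y).
  apply: (@zmem_min (fun m => m ∈ lam /\ J m ∈ m) a); split=> //.
  by case: (ord_memVsub (app_ord al) (lam_ord al)).
apply: (mmin _ mJ); split; first exact: app_lam.
by apply: (proj1 (app_mem _ _)) => //; [exact/appM/lam_M|exact: lam_M].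
Qed.

Lemma app_mono a b : a ∈ lam -> b ∈ lam -> a ⊆ b -> J a ⊆ J b.
Proof. by move=> al bl; apply: (proj1 (app_sub _ _)); apply: lam_M. Qed.

(** An embedding fixing the ordinals below [a] fixes [V_a] pointwise: induction on
    rank, comparing the elements of [x] and [j(x)] inside [V_b = j(V_b)]. *)
Lemma app_fixed_V a : ordinal_set a -> a ⊆ lam -> (forall b, b ∈ a -> J b = b) ->
  forall x, x ∈ Vset a -> J x = x.
Proof.
elim/zmem_ind: a => a IH oa al ja x /mem_Vset[b ba xb].
have bl := al _ ba; have VM := VsetM bl; have xM := Vset_down VM xb.
have IHb : forall y, y ∈ Vset b -> J y = y.
  apply: (IH b ba (ord_mem oa ba)) => c cb; last by apply/ja/(ord_trans oa ba).
  exact/al/(ord_trans oa ba).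
apply: zsub_antisym => y yx.
  have yb : y ∈ Vset b.
    have : J x ⊆ J (Vset b) by apply: (proj1 (app_sub _ _)).
    by rewrite app_Vset // (ja b) //; apply.
  apply: (proj2 (app_mem _ _)) => //; last by rewrite IHb.
  exact: memM yb VM.
by rewrite -(IHb _ (xb _ yx)); apply: (proj1 (app_mem _ _)) => //; apply: memM yx xM.
Qed.

End OneEmbedding.

Section Critical.
Variable j : zfset.
Hypothesis Ej : Emb lam j.
Local Notation "'J' x" := (app j x) (at level 9, x at level 8).

Let ej : elementary M j := Ej.1.

(** A nontrivial embedding moves an ordinal, by [app_fixed_V] at [λ], so [cr] does
    not take its default value. *)
Lemma crP : [/\ cr j ∈ lam, J (cr j) <> cr j & forall b, b ∈ cr j -> J b = b].
Proof.
have [k [ok mk kmin]] : exists k, [/\ ordinal_set k, moved j k &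
    forall b, b ∈ k -> ~ moved j b].
  have [k [ok mk] kmin] : exists2 k, ordinal_set k /\ moved j k &
      forall y, y ∈ k -> ~ (ordinal_set y /\ moved j y).
    suff [k ok] : exists k, ordinal_set k /\ moved j k.
      exact: (@zmem_min (fun k => ordinal_set k /\ moved j k) k).
    apply: contrapT => no; have [x /movedP-/(_ ej)[xM]] := Ej.2; apply.
    apply: (app_fixed_V ej (lim_ord hlam)) xM => // b bl; apply: contrapT => n.
    apply: no; exists b; split; first exact: lam_ord.
    by apply/movedP => //; split=> //; apply: lam_M.
  exists k; split=> // b bk mb; apply: (kmin b bk); split=> //.
  exact: (ord_mem ok).
have : [/\ ordinal_set (cr j), moved j (cr j) & forall b, b ∈ cr j -> ~ moved j b].
  rewrite /cr; apply: (@xgetPex _ zempty [set k | [/\ ordinal_set k, moved j k &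
                           forall b, b ∈ k -> ~ moved j b]]).
  by exists k.
case=> oc /(movedP ej)[cM nc] cmin; split=> //; first exact: M_lam.
move=> b bc; apply: contrapT => n; apply: (cmin b bc); apply/movedP => //.
by split=> //; apply: memM bc cM.
Qed.

Lemma cr_lam : cr j ∈ lam. Proof. by case: crP. Qed.
Lemma cr_ord : ordinal_set (cr j). Proof. exact/lam_ord/cr_lam. Qed.
Lemma cr_M : cr j ∈ M. Proof. exact/lam_M/cr_lam. Qed.
Lemma cr_fixed b : b ∈ cr j -> J b = b. Proof. by case: crP => _ _; apply. Qed.

Lemma cr_lt : cr j ∈ J (cr j).
Proof.
have cl := cr_lam; have [_ n _] := crP.
by case: (ord_sub_mem cr_ord (app_ord ej cl) (app_ge ej cl)) => // e; case: n.
Qed.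

Lemma cr_unique k : k ∈ lam -> J k <> k -> (forall b, b ∈ k -> J b = b) -> cr j = k.
Proof.
move=> kl nk kf; have [cl nc cf] := crP.
case: (ord_total cr_ord (lam_ord kl)) => //; [by move=> /kf|by move=> /cf].
Qed.

Lemma cr_fixed_V x : x ∈ Vset (cr j) -> J x = x.
Proof.
apply: (app_fixed_V ej cr_ord); last exact: cr_fixed.
exact/(ord_trans (lim_ord hlam))/cr_lam.
Qed.

Lemma cr_lim : lim (cr j).
Proof.
have [cl nc cf] := crP.
split; first exact: cr_ord.
  case: (ord_sub_mem ord_empty cr_ord (@sub_empty _)) => // e.
  by case: nc; rewrite -e; apply: app_empty.
move=> y yc; have oy := ord_mem cr_ord yc.
case: (ord_sub_mem (ord_succ oy) cr_ord (succ_sub cr_ord yc)) => // e.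
by case: nc; rewrite -e app_succ ?cf //; apply: memM yc cr_M.
Qed.

Lemma omega_lam : omega ∈ lam.
Proof.
have [cl nc cf] := crP.
apply: (ord_le_lt ord_omega cr_ord (lim_ord hlam) _ cl).
exact/omega_sub_lim/cr_lim.
Qed.

Lemma omegaM : omega ∈ M. Proof. exact/lam_M/omega_lam. Qed.

End Critical.
End Elementary.

(** * The fixed points of an embedding *)

Definition tail_eq (X : Type) (s t : nat -> X) : Prop :=
  exists a b, forall n, s (a + n) = t (b + n).

Lemma tail_eq_trans (X : Type) (t s u : nat -> X) :
  tail_eq s t -> tail_eq t u -> tail_eq s u.
Proof.
move=> [a [b st]] [c [d tu]]; exists (a + c), (d + b) => n.
by rewrite -!addnA st addnCA tu.
Qed.

Lemma tail_eq_sym (X : Type) (s t : nat -> X) : tail_eq s t -> tail_eq t s.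
Proof. by move=> [a [b st]]; exists b, a => n. Qed.

(** Erdős and Hajnal, after Galvin and Prikry: choose a representative in each
    class of sequences with a common tail.  Deep inside an injective [s], the tail
    of [s] past [m] occurs at exactly one place in the representative, and the
    entry there just before it is [s m]; so [f] can recover [s m] from the tail. *)
Lemma predecessor_function (X : Type) :
  exists f : (nat -> X) -> X,
    (forall x, f (fun=> x) = x) /\
    forall s, injective s -> exists m, f (fun n => s (m + n).+1) = s m.
Proof.
have [[x0]|noX] := pselect (inhabited X); last first.
  exists (fun s => s 0); split=> // s; by case: noX; split; apply: (s 0).
have [rep repP] : {rep : set (nat -> X) -> nat -> X &
    forall A : set (nat -> X), A !=set0 -> A (rep A)}.
  apply: (@choice _ _ (fun (A : set (nat -> X)) t => A !=set0 -> A t)) => A.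
  have [[t At]|n] := pselect (A !=set0); first by exists t.
  by exists (fun=> x0).
pose r s := rep (tail_eq s).
have rP s : tail_eq s (r s) by apply: (repP (tail_eq s)); exists s, 0, 0.
have rE s t : tail_eq s t -> r s = r t.
  move=> st; congr rep; apply: funext => u; apply: propext; split.
    exact/tail_eq_trans/tail_eq_sym.
  exact: tail_eq_trans.
pose prec s y := exists p, r s p = y /\ forall n, r s (p + n).+1 = s n.
have [f fP] : {f : (nat -> X) -> X & forall s,
    (~ injective s -> f s = s 0) /\
    (injective s -> (exists y, prec s y) -> prec s (f s))}.
  apply: (@choice _ _ (fun s y => (~ injective s -> y = s 0) /\
    (injective s -> (exists y, prec s y) -> prec s y))) => s.
  have [js|js] := pselect (injective s); last by exists (s 0).
  have [[y hy]|n] := pselect (exists y, prec s y); first by exists y.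
  by exists (s 0).
exists f; split=> [x|s js].
  apply: (fP (fun=> x)).1 => /(_ 0 1 erefl) //.
have [m [a ra]] := rP s; exists m.
set t := fun n => s (m + n).+1.
have jt : injective t by move=> i k /js /eqP; rewrite eqSS eqn_add2l => /eqP.
have rt : r t = r s.
  by apply: rE; exists 0, m.+1 => n; rewrite add0n addSn.
have ex : exists y, prec t y.
  exists (s m), a; rewrite rt -[in LHS](addn0 a) -ra addn0; split=> // n.
  by rewrite -addnS -ra addnS.
have [p [<- pt]] := (fP t).2 jt ex.
suff -> : p = a by rewrite rt -[in LHS](addn0 a) -ra addn0.
have pt' n : r s (p + n).+1 = s (m + n).+1 by rewrite -rt pt.
have key i k : p + i = a + k -> i = k.
  move=> e; have := pt' i; rewrite e -addnS -ra addnS => /js /eqP.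
  by rewrite eqSS eqn_add2l eq_sym => /eqP.
case/orP: (leq_total p a) => [/subnKC|/subnKC] e.
  by have := key (a - p) 0; rewrite addn0 e => /(_ erefl) e0; rewrite -e e0 addn0.
by have := key 0 (p - a); rewrite addn0 e => /(_ erefl) e0; rewrite -e -e0 addn0.
Qed.

(** On the range of a suitable injection [e], the function [f0] given by
    [predecessor_function] has the required property, and [f] is [f0] transported
    along [e].  Otherwise, shrinking the range of [e] again and again gives
    [e_0, e_1, ...] with decreasing ranges, and points [a_n] in the range of [e_n]
    that [f0] does not reach from sequences in the range of [e_(n+1)].  These points
    form an injective sequence whose tails contradict the choice of [f0]. *)
Lemma omega_jonsson (X : Type) :
  exists f : (nat -> X) -> X,
    forall d : X -> X, injective d -> forall c, exists s, f (d \o s) = c.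
Proof.
have [f0 [f0cst f0inj]] := predecessor_function X.
have [e je eP] : exists2 e : X -> X, injective e &
    forall d : X -> X, injective d -> forall c, exists s, f0 (e \o d \o s) = e c.
  apply: contrapT => no.
  have [D DP] : {D : {e : X -> X | injective e} -> {d : X -> X | injective d} * X &
      forall e, forall s, f0 (sval e \o sval (D e).1 \o s) <> sval e (D e).2}.
    apply: (@choice _ _ (fun (e : {e : X -> X | injective e})
      (dx : {d : X -> X | injective d} * X) =>
        forall s, f0 (sval e \o sval dx.1 \o s) <> sval e dx.2)) => -[e je] /=.
    apply: contrapT => no'; apply: no; exists e => // d jd c.
    apply: contrapT => no''; apply: no'; exists (exist _ d jd, c) => s /= E.
    by apply: no''; exists s.
  pose next (e : {e : X -> X | injective e}) : {e : X -> X | injective e} :=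
    exist _ (sval e \o sval (D e).1) (inj_comp (svalP e) (svalP (D e).1)).
  pose E n := iter n next (exist _ id (@inj_id X)).
  pose a n := sval (E n) (D (E n)).2.
  have fac n k : exists h : X -> X, sval (E (n + k)) = sval (E n) \o h.
    elim: k => [|k [h hE]]; first by exists id; rewrite addn0.
    exists (h \o sval (D (E (n + k))).1).
    by rewrite addnS [sval (E _.+1)]/= -/(E _) hE.
  have afac n k : exists z, a (n + k).+1 = sval (E n.+1) z.
    have [h hE] := fac n.+1 k; exists (h (D (E (n.+1 + k))).2).
    by rewrite /a -addSn hE.
  have aP n s : f0 (sval (E n.+1) \o s) <> a n by exact: DP.
  have aN n k : a (n + k).+1 <> a n.
    (* [f0] of a constant sequence is its value, so missing [a n] as a value
       of [f0] includes missing it as an entry *)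
    have [z ->] := afac n k => E'; apply: (aP n (fun=> z)); rewrite -E'.
    exact: (f0cst (sval (E n.+1) z)).
  have ja : injective a.
    move=> n m; case: (ltngtP n m) => // /subnKC <-; rewrite addSn => E'.
      by case: (aN _ _ (esym E')).
    by case: (aN _ _ E').
  have [m am] := f0inj a ja.
  have [z zP] := choice (afac m).
  apply: (aP m z); rewrite -am; congr f0; apply: funext => n /=.
  by rewrite zP.
pose f s := xget (s 0 : {classic X}) [set x | e x = f0 (e \o s)].
exists f => d jd c; have [s sP] := eP d jd c; exists s.
apply: (@xget_unique {classic X} _ _ c) => [|y] /=; first by rewrite -sP.
by rewrite -[e y = _]/(e y = f0 (e \o d \o s)) sP => /je.
Qed.

Lemma sval_inj (T : Type) (P : T -> Prop) (u v : {x | P x}) : sval u = sval v -> u = v.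
Proof.
by case: u v => x p [y q] /= e; case: _ / e q => q; congr exist; apply: Prop_irrelevance.
Qed.

Section SetFunctions.
Variable lam : zfset.
Hypothesis hlam : lim lam.
Local Notation M := (Vset lam).
Local Notation definable := (definable lam).

Lemma cupM y : y ∈ M -> zcup y ∈ M.
Proof.
move=> /mem_Vset[b bl yb]; apply/mem_Vset; exists b => // z /mem_zcup[w wy zw].
exact: Vset_trans (yb _ wy) _ zw.
Qed.

Definition zprod (A B : zfset) : zfset :=
  zsep (fun p => exists2 x, x ∈ A & exists2 y, y ∈ B & p = opair x y)
       (zpow (zpow (zcup (zpair A B)))).

Lemma mem_zprod A B x y : opair x y ∈ zprod A B <-> x ∈ A /\ y ∈ B.
Proof.
rewrite mem_zsep; split=> [[_ [x' xA [y' yB /opair_inj[-> ->]]]]//|[xA yB]].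
split; last by exists x => //; exists y.
have xU : x ∈ zcup (zpair A B) by apply/mem_zcup; exists A; rewrite ?mem_zpair; auto.
have yU : y ∈ zcup (zpair A B) by apply/mem_zcup; exists B; rewrite ?mem_zpair; auto.
by apply/mem_zpow => z /mem_zpair[]->; apply/mem_zpow => w /mem_zpair[]->.
Qed.

Lemma prodM A B : A ∈ M -> B ∈ M -> zprod A B ∈ M.
Proof.
move=> AM BM; apply: (@Vset_down _ (zpow (zpow (zcup (zpair A B))))).
  by do 2 apply: lim_pow => //; apply: cupM; apply: lim_zpair.
by move=> p /mem_zsep[].
Qed.

Definition zfun (s w X : zfset) : Prop :=
  (forall p, p ∈ s -> exists2 n, n ∈ w & exists2 x, x ∈ X & p = opair n x) /\
  ((forall n, n ∈ w -> exists2 x, x ∈ X & prel s n x) /\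
   (forall n, n ∈ w -> forall x, x ∈ X -> forall y, y ∈ X ->
      prel s n x -> prel s n y -> x = y)).

Lemma zfun_definable i k l : definable (fun e => zfun (e i) (e k) (e l)).
Proof.
rewrite /zfun; apply: definable_and; last apply: definable_and.
- apply: definable_ball; do 2 apply: definable_bex; exact: (@opair_definable _ 2 1 0).
- apply: definable_ball; apply: definable_bex; exact: (@prel_definable _ _ 1 0).
- do 3 apply: definable_ball; apply: definable_imp; first exact: (@prel_definable _ _ 2 1).
  apply: definable_imp; first exact: (@prel_definable _ _ 2 0).
  exact: (@definable_eq _ 1 0).
Qed.

Lemma zfun_eq s t w X : zfun s w X -> zfun t w X ->
  (forall n, n ∈ w -> forall x, x ∈ X -> prel s n x -> prel t n x) -> s = t.
Proof.
move=> [s1 [s2 s3]] [t1 [t2 t3]] st; apply: zsub_antisym => p.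
  by move=> ps; have [n nw [x xX e]] := s1 _ ps; rewrite e in ps *; apply: st.
move=> pt; have [n nw [x xX e]] := t1 _ pt; rewrite {p}e in pt *.
have [y yX sny] := s2 n nw.
by rewrite (t3 n nw x xX y yX pt (st _ nw _ yX sny)).
Qed.

Lemma zfunM s w X : w ∈ M -> X ∈ M -> zfun s w X -> s ∈ M.
Proof.
move=> wM XM [s1 _]; apply: (Vset_down (prodM wM XM)) => p ps.
by have [n nw [x xX ->]] := s1 _ ps; apply/mem_zprod.
Qed.

Definition seqset (X : zfset) (t : nat -> {x | x ∈ X}) : zfset :=
  zrange (fun n => opair (vn n) (sval (t n))).

Lemma prel_seqset X (t : nat -> {x | x ∈ X}) n x :
  prel (seqset t) (vn n) x <-> x = sval (t n).
Proof.
rewrite /prel /seqset mem_zrange; split=> [[m /opair_inj[/vn_inj-> ->]]//|->].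
by exists n.
Qed.

Lemma zfun_seqset X (t : nat -> {x | x ∈ X}) : zfun (seqset t) omega X.
Proof.
split=> [_ /mem_zrange[n <-]|].
  exists (vn n); first by apply/mem_omega; exists n.
  by exists (sval (t n)) => //; exact: (svalP (t n)).
split=> _ /mem_omega[n <-].
  by exists (sval (t n)); [exact: (svalP (t n))|apply/prel_seqset].
by move=> x xX y yX /prel_seqset-> /prel_seqset->.
Qed.

Lemma zfun_seqsetP X s : zfun s omega X -> exists t : nat -> {x | x ∈ X}, s = seqset t.
Proof.
move=> fs; have [s1 [s2 s3]] := fs.
have : forall n, exists x : {x | x ∈ X}, prel s (vn n) (sval x).
  move=> n; have [|x xX nx] := s2 (vn n); first by apply/mem_omega; exists n.
  by exists (exist _ x xX).
move=> /choice[t tP]; exists t; apply/esym/(zfun_eq (zfun_seqset t) fs).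
by move=> _ /mem_omega[n <-] x xX /prel_seqset->.
Qed.

Definition zinj (d X : zfset) : Prop :=
  (forall x, x ∈ X -> exists2 y, y ∈ X & prel d x y) /\
  ((forall x, x ∈ X -> forall y, y ∈ X -> forall z, z ∈ X ->
      prel d x y -> prel d x z -> y = z) /\
   (forall x, x ∈ X -> forall y, y ∈ X -> forall z, z ∈ X ->
      prel d x z -> prel d y z -> x = y)).

Lemma zinj_definable i k : definable (fun e => zinj (e i) (e k)).
Proof.
rewrite /zinj; apply: definable_and; last apply: definable_and.
- apply: definable_ball; apply: definable_bex; exact: (@prel_definable _ _ 1 0).
- do 3 apply: definable_ball; apply: definable_imp; first exact: (@prel_definable _ _ 2 1).
  apply: definable_imp; first exact: (@prel_definable _ _ 2 0).
  exact: (@definable_eq _ 1 0).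
- do 3 apply: definable_ball; apply: definable_imp; first exact: (@prel_definable _ _ 2 0).
  apply: definable_imp; first exact: (@prel_definable _ _ 1 0).
  exact: (@definable_eq _ 2 1).
Qed.

(** The conclusion of [omega_jonsson], for [w = ω], as a first-order property of sets
    in [V_λ]. *)
Definition jonsson (f w X : zfset) : Prop :=
  (forall d, d ∈ M -> zinj d X -> forall c, c ∈ X ->
     exists2 s, s ∈ M & exists2 s', s' ∈ M &
       (zfun s w X /\ zfun s' w X) /\
       ((forall n, n ∈ w -> forall x, x ∈ X -> forall y, y ∈ X ->
          prel s n x -> prel d x y -> prel s' n y) /\ prel f s' c)) /\
  ((forall s, s ∈ M -> zfun s w X -> exists2 y, y ∈ X & prel f s y) /\
   (forall s, s ∈ M -> forall y, y ∈ X -> forall z, z ∈ X ->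
      prel f s y -> prel f s z -> y = z)).

Lemma jonsson_definable i k l : definable (fun e => jonsson (e i) (e k) (e l)).
Proof.
rewrite /jonsson; apply: definable_and; last apply: definable_and.
- apply: definable_all; apply: definable_imp; first exact: (@zinj_definable 0).
  apply: definable_ball; do 2 apply: definable_ex; apply: definable_and; apply: definable_and.
  + exact: (@zfun_definable 1).
  + exact: (@zfun_definable 0).
  + do 3 apply: definable_ball; apply: definable_imp; first exact: (@prel_definable _ 4 2 1).
    apply: definable_imp; first exact: (@prel_definable _ 6 1 0).
    exact: (@prel_definable _ 3 2 0).
  + exact: (@prel_definable _ _ 0 2).
- apply: definable_all; apply: definable_imp; first exact: (@zfun_definable 0).
  apply: definable_bex; exact: (@prel_definable _ _ 1 0).
- apply: definable_all; do 2 apply: definable_ball; apply: definable_imp.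
    exact: (@prel_definable _ _ 2 1).
  apply: definable_imp; first exact: (@prel_definable _ _ 2 0).
  exact: (@definable_eq _ 1 0).
Qed.

Lemma jonsson_ex X : omega ∈ M -> X ∈ M -> exists2 f, f ∈ M & jonsson f omega X.
Proof.
move=> oM XM; have [F FP] := omega_jonsson {x | x ∈ X}.
pose S := zpow (zprod omega X).
have SM : S ∈ M by apply: lim_pow => //; apply: prodM.
have seqS (t : nat -> {x | x ∈ X}) : seqset t ∈ S.
  apply/mem_zpow => p /mem_zrange[n <-]; apply/mem_zprod; split; last exact: (svalP (t n)).
  by apply/mem_omega; exists n.
pose f := zsep (fun p => exists t, p = opair (seqset t) (sval (F t))) (zprod S X).
have fP t x : prel f (seqset t) x <-> x = sval (F t).
  rewrite /prel mem_zsep; split=> [[_ [u /opair_inj[e ->]]]|->].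
    congr (sval (F _)); apply: funext => n; apply: sval_inj.
    by apply/prel_seqset; rewrite e; apply/prel_seqset.
  by split; [apply/mem_zprod; split=> //; exact: (svalP (F t))|exists t].
exists f; first by apply: (Vset_down (prodM SM XM)) => p /mem_zsep[].
split=> [d dM [d1 [d2 d3]] c cX|].
  have [D DP] : {D : {x | x ∈ X} -> {x | x ∈ X} & forall x, prel d (sval x) (sval (D x))}.
    apply: (@choice _ _ (fun x y : {x | x ∈ X} => prel d (sval x) (sval y))) => -[x xX].
    by have [y yX xy] := d1 x xX; exists (exist _ y yX).
  have jD : injective D.
    move=> x y e; apply: sval_inj.
    apply: (d3 _ (svalP x) _ (svalP y) _ (svalP (D x))); first exact: DP.
    by rewrite e; exact: DP.
  have [s sc] := FP D jD (exist _ c cX).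
  have sM t : seqset t ∈ M := memM (seqS t) SM.
  exists (seqset s) => //; exists (seqset (D \o s)) => //.
  split; first by split; apply: zfun_seqset.
  split; last by apply/fP; rewrite sc.
  move=> _ /mem_omega[n <-] x xX y yX /prel_seqset-> sy; apply/prel_seqset.
  exact: (d2 _ (svalP (s n)) _ yX _ (svalP (D (s n))) sy (DP (s n))).
split=> [s sM /zfun_seqsetP[t ->]|s sM y yX z zX sy].
  by exists (sval (F t)); [exact: (svalP (F t))|apply/fP].
have [_ [t /opair_inj[e _]]] := (mem_zsep _ _ _).1 sy; move: sy.
by rewrite e => /fP-> /fP->.
Qed.

(** The restriction of [j] to [X] is an injection in [V_λ], so [j(f)] takes every
    value of [X] at some sequence in its range, and such a sequence is [j(s)]
    because [j] fixes [ω] pointwise. *)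
Lemma kunen j X : Emb lam j -> X ∈ M -> app j X = X ->
  forall c, c ∈ X -> exists2 x, x ∈ X & app j x = c.
Proof.
move=> Ej XM jX c cX; have ej := Ej.1; have oM := omegaM hlam Ej.
have [f fM fX] := jonsson_ex oM XM.
have [_ [ft ff]] := fX.
have [jft [_ jff]] := (elem3 ej fM oM XM (jonsson_definable 0 1 2)).1 fX.
rewrite jX (app_omega ej oM) in jft jff.
pose d := zimage (fun x => opair x (app j x)) X.
have XX x : x ∈ X -> app j x ∈ X.
  by move=> xX; rewrite -jX; apply: (app_mem ej _ XM).1 => //; apply: memM XM.
have Xm x : x ∈ X -> x ∈ M by move=> xX; apply: memM XM.
have dP x y : x ∈ X -> prel d x y <-> y = app j x.
  move=> xX; rewrite /prel mem_zimage; split=> [[z _ /opair_inj[-> ->]]//|->].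
  by exists x.
have dM : d ∈ M.
  apply: (Vset_down (prodM XM XM)) => p; rewrite mem_zimage => -[x xX <-].
  by apply/mem_zprod; split=> //; apply: XX.
have dX : zinj d X.
  split=> [x xX|]; first by exists (app j x); [exact: XX|exact/dP].
  split=> x xX y yX z zX; first by move=> /(dP _ _ xX)-> /(dP _ _ xX)->.
  by move=> /(dP _ _ xX)-> /(dP _ _ yX) /(app_inj ej (Xm _ xX) (Xm _ yX)).
have [s sM [s' s'M [[fs fs'] [ss' s'c]]]] := jft d dM dX c cX.
have [y yX sy] := ft s sM fs.
have fjs := (elem3 ej sM oM XM (zfun_definable 0 1 2)).1 fs.
rewrite jX (app_omega ej oM) in fjs.
have e : s' = app j s.
  apply/esym/(zfun_eq fjs fs') => n no x xX jsnx.
  have [x' x'X snx'] := fs.2.1 n no.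
  have nE : app j n = n.
    by move: no => /mem_omega[m <-]; exact: (app_vn hlam ej (vnM hlam m)).
  have jx' : prel (app j s) n (app j x').
    by rewrite -{1}nE; apply: (app_prel ej sM _ _).1 => //; [apply: memM oM|apply: Xm].
  rewrite (fjs.2.2 n no x xX _ (XX _ x'X) jsnx jx').
  by apply: (ss' n no x' x'X _ (XX _ x'X) snx'); apply/dP.
exists y => //; apply: (jff _ (appM ej sM) _ (XX _ yX) _ cX); last by rewrite -e.
by apply: (app_prel ej fM sM _).1 => //; apply: Xm.
Qed.

(** A permutation of [a] induced by [j] would have the critical point in its range,
    but [j(x) = cr j] is impossible: [x < cr j] is fixed, and [j(x) > cr j] from
    [x = cr j] on. *)
Lemma kunen_cr j a : Emb lam j -> a ∈ lam -> app j a = a -> ~ cr j ∈ a.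
Proof.
move=> Ej al ja ca; have ej := Ej.1.
have [x xa jx] := kunen Ej (lam_M al) ja ca.
have xl : x ∈ lam by apply: (ord_trans (lim_ord hlam) al).
have := app_ge hlam ej xl; rewrite jx => xc.
case: (ord_sub_mem (lam_ord hlam xl) (cr_ord hlam Ej) xc) => [e|].
  by have [_ + _] := crP hlam Ej; rewrite -{1}e jx.
move=> xin; have := cr_fixed hlam Ej xin; rewrite jx => e.
by move: xin; rewrite -e => /zmem_irr.
Qed.

End SetFunctions.

(** * The critical sequence *)

Lemma ord_cup x : (forall y, y ∈ x -> ordinal_set y) -> ordinal_set (zcup x).
Proof.
move=> ox; split=> [y /mem_zcup[z zx yz] w wy|y z].
  by apply/mem_zcup; exists z => //; apply: (ord_trans (ox _ zx) yz).
move=> /mem_zcup[u ux yu] /mem_zcup[v vx zv].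
have oy := ord_mem (ox _ ux) yu; have oz := ord_mem (ox _ vx) zv.
by case: (ord_total oy oz); [left|right; left|right; right].
Qed.

Section CriticalSequence.
Variable lam : zfset.
Hypothesis hlam : lim lam.
Local Notation M := (Vset lam).
Local Notation definable := (definable lam).

(** Embeddings are continuous at limits of countable sequences, because the
    image of such a sequence is its pointwise image. *)
Lemma app_fixed_sup k g (c : nat -> zfset) : Emb lam k -> g ∈ lam ->
  (forall n, c n ∈ g) -> (forall b, b ∈ g -> exists n, b ⊆ c n) ->
  (forall n, app k (c n) ∈ g) -> app k g = g.
Proof.
move=> Ek gl cg cof kcg; have ek := Ek.1; have oM := omegaM hlam Ek.
have gM := lam_M gl; have og := lam_ord hlam gl.
pose s := seqset (fun n => exist (fun x => x ∈ g) (c n) (cg n)).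
have fs : zfun s omega g := zfun_seqset _.
have sM : s ∈ M := zfunM hlam oM gM fs.
have sE n x : prel s (vn n) x <-> x = c n by exact: prel_seqset.
pose P s w g := forall b, b ∈ g -> exists2 n, n ∈ w &
  exists2 x, x ∈ g & prel s n x /\ b ⊆ x.
have Pd : definable (fun e => P (e 0) (e 1) (e 2)).
  rewrite /P; apply: definable_ball; do 2 apply: definable_bex; apply: definable_and.
    exact: (@prel_definable _ 3 1 0).
  exact: (@sub_definable _ 2 0).
have Ps : P s omega g.
  move=> b /cof[n bn]; exists (vn n); first by apply/mem_omega; exists n.
  by exists (c n) => //; split=> //; apply/sE.
have := (elem3 ek sM oM gM Pd).1 Ps.
have := (elem3 ek sM oM gM (zfun_definable _ 0 1 2)).1 fs.
rewrite (app_omega ek oM) => fks Pks; apply: zsub_antisym; last exact: (app_ge hlam ek gl).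
move=> b bkg; have [_ /mem_omega[n <-] [x xkg [nx bx]]] := Pks b bkg.
have cM : c n ∈ M by apply: memM gM.
have nx' : prel (app k s) (vn n) (app k (c n)).
  rewrite -(app_vn hlam ek (vnM hlam n)); apply: (app_prel ek sM _ cM).1.
    exact: vnM.
  exact/sE.
have ex : x = app k (c n).
  apply: (fks.2.2 (vn n) _ x xkg _ _ nx nx'); first by apply/mem_omega; exists n.
  by apply: (app_mem ek cM gM).1.
have xg : x ∈ g by rewrite ex.
apply: (ord_le_lt _ (ord_mem og xg) og bx xg).
exact: (ord_mem (app_ord hlam ek gl) bkg).
Qed.

Definition crseq k n := iter n (app k) (cr k).

Lemma crseq_lam k n : Emb lam k -> crseq k n ∈ lam.
Proof.
move=> Ek; elim: n => [|n IH]; first exact: cr_lam.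
exact: (app_lam hlam Ek.1 IH).
Qed.

Lemma crseq_lt k n : Emb lam k -> crseq k n ∈ crseq k n.+1.
Proof.
move=> Ek; elim: n => [|n IH]; first exact: (cr_lt hlam Ek).
have M' m : crseq k m ∈ M by apply/lam_M/crseq_lam.
exact: (app_mem Ek.1 (M' n) (M' n.+1)).1.
Qed.

Lemma crseq_lim k n : Emb lam k -> lim (crseq k n).
Proof.
move=> Ek; elim: n => [|n IH]; first exact: (cr_lim hlam Ek).
by apply: (app_lim Ek.1 _ IH); apply/lam_M/crseq_lam.
Qed.

(** The supremum of the critical sequence would be fixed if it were below [λ],
    contrary to [kunen_cr]. *)
Lemma crseq_cofinal k a : Emb lam k -> a ∈ lam -> exists n, a ∈ crseq k n.
Proof.
move=> Ek al; apply: contrapT => no.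
have ka n : crseq k n ⊆ a.
  have cl := crseq_lam n Ek.
  case: (ord_memVsub (lam_ord hlam al) (lam_ord hlam cl)) => // h.
  by case: no; exists n.
pose g := zcup (zrange (crseq k)).
have gP b : b ∈ g <-> exists n, b ∈ crseq k n.
  rewrite mem_zcup; split=> [[_ /mem_zrange[n <-] bn]|[n bn]]; first by exists n.
  by exists (crseq k n) => //; apply/mem_zrange; exists n.
have og : ordinal_set g.
  by apply: ord_cup => _ /mem_zrange[n <-]; apply/(lam_ord hlam)/crseq_lam.
have gl : g ∈ lam.
  apply: (ord_le_lt og (lam_ord hlam al) (lim_ord hlam) _ al).
  by move=> b /gP[n]; apply: ka.
have cg n : crseq k n ∈ g by apply/gP; exists n.+1; apply: crseq_lt.
apply: (kunen_cr hlam Ek gl); last exact: (cg 0).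
apply: (app_fixed_sup Ek gl cg) => [b /gP[n bn]|n]; last exact: (cg n.+1).
by exists n; apply: (ord_trans _ bn); apply/(lam_ord hlam)/crseq_lam.
Qed.

(** * Applying an embedding to an embedding *)

Lemma definable_sat phi p (r : nat -> nat) : definable (fun e => sat (e p) (fun i => e (r i)) phi).
Proof.
elim: phi p r => [m n|m n||f IHf g IHg|f IH] p r /=.
- exact: definable_mem.
- exact: definable_eq.
- exact: definable_false.
- exact: definable_imp.
- apply: definable_ball.
  apply: (definable_ext (IH p.+1 (fun i => if i is i'.+1 then (r i').+1 else 0))) => e _.
  suff -> : scons (e 0) (fun i => e (r i).+1) =
            (fun i => e (if i is i'.+1 then (r i').+1 else 0)) by [].
  by apply: funext; case.
Qed.

Lemma sat_support phi : exists N, forall a e e',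
  (forall i, (i < N)%N -> e i = e' i) -> sat a e phi <-> sat a e' phi.
Proof.
elim: phi => [m n|m n||f [N1 h1] g [N2 h2]|f [N h]].
- by exists (maxn m n).+1 => a e e' H /=; rewrite !H // ltnS leq_max leqnn ?orbT.
- by exists (maxn m n).+1 => a e e' H /=; rewrite !H // ltnS leq_max leqnn ?orbT.
- by exists 0.
- exists (maxn N1 N2) => a e e' H /=.
  rewrite (h1 a e e') ?(h2 a e e') // => i iN; apply: H;
    by rewrite leq_max iN ?orbT.
- exists N => a e e' H /=; split=> H' x xa; have := H' x xa; apply: (h _ _ _ _).1;
    case=> // i iN /=; [|apply: esym]; exact/H/ltnW.
Qed.

(** The environment with [E] in the first [n] positions and [e] after them; it serves
    to quantify over [n] variables at once. *)
Definition block n (E e : nat -> zfset) m := if (m < n)%N then E m else e (m - n).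

Lemma definable_block n (P : (nat -> zfset) -> Prop) : definable P ->
  definable (fun e => forall E, (forall m, E m ∈ M) -> P (block n E e)).
Proof.
elim: n => [|n IH] in P *.
  move=> dP; apply: (definable_ext dP) => e eM.
  have bE E : block 0 E e = e by apply: funext => m; rewrite /block subn0.
  by split=> [/(_ e eM)|Pe E _]; rewrite bE.
move=> /IH dP.
pose Q x e := forall E, (forall m, E m ∈ M) -> P (block n E (scons x e)).
apply: (@definable_ext _ _ (fun e => forall x, x ∈ M -> Q x e)).
  apply: definable_all; apply: (definable_ext dP) => e _.
  by rewrite /Q -scons_eta.
move=> e eM; split=> [H x xM E EM|H E EM].
  have -> : block n E (scons x e) = block n.+1 (fun m => if m == n then x else E m) e.
    apply: funext => m; rewrite /block ltnS; case: (ltngtP m n) => [mn|nm|->].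
    - by [].
    - by case: m nm => // m nm; rewrite subSS subSn.
    - by rewrite subnn.
  by apply: H => m; case: ifP.
have -> : block n.+1 E e = block n E (scons (E n) e).
  apply: funext => m; rewrite /block ltnS; case: (ltngtP m n) => [mn|nm|->].
  - by [].
  - by case: m nm => // m nm; rewrite subSS subSn.
  - by rewrite subnn.
exact: H.
Qed.

Definition eemb (f a b : zfset) : Prop := forall phi x y,
  (forall i, prel f (x i) (y i)) -> sat a x phi <-> sat b y phi.

(** For one formula [phi] with [N] variables, elementarity of [f] is the first-order
    statement [Q] below on [a], [b], [f], universally quantified over [N] pairs in
    [f], placed at positions [2i] and [2i + 1]. *)
Lemma eemb_app j f a b : elementary M j -> f ∈ M -> a ∈ M -> b ∈ M ->
  (exists x y, prel f x y) -> eemb f a b -> eemb (app j f) (app j a) (app j b).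
Proof.
move=> ej fM aM bM [x0 [y0 f0]] fab phi.
have [N HN] := sat_support phi.
pose Q e := (forall i, (i < N)%N -> prel (e (N.*2).+2) (e i.*2) (e i.*2.+1)) ->
  (sat (e N.*2) (fun i => e i.*2) phi <-> sat (e (N.*2).+1) (fun i => e i.*2.+1) phi).
have dQ : definable Q.
  apply: definable_imp; last by apply: definable_iff; apply: definable_sat.
  elim: {1}N => [|n [p IH]];
    first by exists (FImp FFalse FFalse) => e _; split=> // _ i.
  apply: (@definable_ext _ _ (fun e => (forall i, (i < n)%N ->
     prel (e (N.*2).+2) (e i.*2) (e i.*2.+1)) /\
     prel (e (N.*2).+2) (e n.*2) (e n.*2.+1))).
    by apply: definable_and; [exists p|apply: prel_definable].
  move=> e _; split=> [H|[H1 H2] i].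
    by split=> [i /ltnW|]; apply: H.
  by rewrite ltnS leq_eqVlt => /orP[/eqP->|/H1].
have dR := definable_block N.*2 dQ.
pose e0 := scons a (scons b (fun=> f)).
have e0M n : e0 n ∈ M by do 2 apply: sconsM => //.
have [x0M y0M] := prelM fM f0.
have low E e i : (i < N)%N -> block N.*2 E e i.*2 = E i.*2 /\
    block N.*2 E e i.*2.+1 = E i.*2.+1.
  move=> iN; rewrite /block ltn_double iN; split=> //.
  by rewrite ltn_Sdouble iN.
have hi E e : [/\ block N.*2 E e N.*2 = e 0, block N.*2 E e N.*2.+1 = e 1 &
    block N.*2 E e N.*2.+2 = e 2].
  by rewrite /block ltnn subnn !ltnNge !leqW // subSnn (subSn (leqW _)) // subSnn.
have R0 : forall E, (forall m, E m ∈ M) -> Q (block N.*2 E e0).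
  move=> E EM; rewrite /Q; have [-> -> ->] := hi E e0 => /= H.
  (* beyond [N] the environment must be filled up with some pair in [f] *)
  pose x i := if (i < N)%N then E i.*2 else x0.
  pose y i := if (i < N)%N then E i.*2.+1 else y0.
  have -> : sat a (fun i => block N.*2 E e0 i.*2) phi <-> sat a x phi.
    by apply: HN => i iN; rewrite /x iN; case: (low E e0 i iN).
  have -> : sat b (fun i => block N.*2 E e0 i.*2.+1) phi <-> sat b y phi.
    by apply: HN => i iN; rewrite /y iN; case: (low E e0 i iN).
  apply: fab => i; rewrite /x /y; case: ifP => // iN; have := H i iN.
  by have [-> ->] := low E e0 i iN.
have R1 := (elem ej dR e0M).1 R0.
move=> x y xy.
pose E m := if odd m then y m./2 else x m./2.
have xyM i := prelM (appM ej fM) (xy i).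
have EM m : E m ∈ M by rewrite /E; case: ifP => _; [case: (xyM m./2)|case: (xyM m./2)].
have Ex i : E i.*2 = x i by rewrite /E odd_double doubleK.
have Ey i : E i.*2.+1 = y i by rewrite /E /= odd_double /= uphalf_double.
have := R1 E EM; rewrite /Q; have [-> -> ->] := hi E (fun n => app j (e0 n)) => /= H.
set e1 := fun n => app j (e0 n) in H.
have <- : sat (app j a) (fun i => block N.*2 E e1 i.*2) phi <-> sat (app j a) x phi.
  by apply: HN => i iN; have [-> _] := low E e1 i iN.
have <- : sat (app j b) (fun i => block N.*2 E e1 i.*2.+1) phi <-> sat (app j b) y phi.
  by apply: HN => i iN; have [_ ->] := low E e1 i iN.
by apply: H => i iN; have [-> ->] := low E e1 i iN; rewrite Ex Ey.
Qed.

Definition esub (a b : zfset) : Prop := a ⊆ b /\ forall phi e,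
  (forall n, e n ∈ a) -> sat a e phi <-> sat b e phi.

Lemma esub_app j a b : elementary M j -> a ∈ M -> b ∈ M -> zempty ∈ a ->
  esub a b -> esub (app j a) (app j b).
Proof.
move=> ej aM bM a0 [ab Hab].
split=> [|phi e ea]; first exact: (app_sub ej aM bM).1.
pose f := zimage (fun x => opair x x) a.
have fP x y : prel f x y <-> x ∈ a /\ x = y.
  rewrite /prel mem_zimage; split=> [[z za /opair_inj[<- <-]]//|[xa <-]].
  by exists x.
have fM : f ∈ M.
  apply: (Vset_down (prodM hlam aM aM)) => p; rewrite mem_zimage => -[x xa <-].
  exact/mem_zprod.
have fab : eemb f a b.
  move=> psi x y xy.
  have -> : y = x by apply: funext => i; case/fP: (xy i).
  by apply: Hab => i; case/fP: (xy i).
apply: (eemb_app ej fM aM bM _ fab); first by exists zempty, zempty; apply/fP.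
move=> i; pose P f a := forall x, x ∈ a -> prel f x x.
have dP : definable (fun e => P (e 0) (e 1)).
  by rewrite /P; apply: definable_ball; apply: (@prel_definable _ 1 0 0).
by apply: ((elem2 ej fM aM dP).1 _ (e i) (ea i)) => x xa; apply/fP.
Qed.

Lemma esub_chain (a : nat -> zfset) :
  (forall n, a n ⊆ M) -> (forall x, x ∈ M -> exists n, x ∈ a n) ->
  (forall n, esub (a n) (a n.+1)) -> forall n, esub (a n) M.
Proof.
move=> aM cov step n; split=> // phi.
have mono m l : (m <= l)%N -> esub (a m) (a l).
  move=> /subnKC <-; elim: (l - m) => [|d [s IH]]; first by rewrite addn0; split.
  rewrite addnS; have [s' h'] := step (m + d); split=> [x /s/s'//|psi e em].
  by rewrite IH // h' // => i; apply: s.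
elim: phi n => [m l|m l||f IHf g IHg|f IH] n e ea //=.
  by rewrite (IHf n e ea) (IHg n e ea).
split=> H x xa; last first.
  by apply: (IH n _ _).2; [case|apply: H; apply: (aM n)].
have [m xm] := cov x xa.
have [sn hn] := mono n (maxn n m) (leq_maxl _ _).
have [sm _] := mono m (maxn n m) (leq_maxr _ _).
apply: (IH (maxn n m) _ _).1; first by case=> [|i] /=; [exact: sm|exact: sn].
exact: ((hn (FAll f) e ea).1 H x (sm _ xm)).
Qed.

Lemma M_crseq k x : Emb lam k -> x ∈ M -> exists n, x ∈ Vset (crseq k n).
Proof.
move=> Ek /(lim_Vset_ex hlam)[b bl xb].
have [n bn] := crseq_cofinal Ek bl; exists n.
by apply: (Vset_mono _ xb); apply: (ord_trans _ bn); apply/(lam_ord hlam)/crseq_lam.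
Qed.

Lemma Vset_crseqM k n : Emb lam k -> Vset (crseq k n) ∈ M.
Proof. by move=> Ek; apply/VsetM/crseq_lam. Qed.

Lemma empty_lim a : lim a -> zempty ∈ Vset a.
Proof. by case=> _ /sub_Vset. Qed.

(** The case [n = 0] holds since [k] fixes [V_κ] pointwise for [κ = cr k]; the other
    cases follow by applying [k].  By [esub_chain], each [V_κ] with [κ] in the
    critical sequence is an elementary substructure of [V_λ]. *)
Lemma crseq_esub k n : Emb lam k -> esub (Vset (crseq k n)) (Vset (crseq k n.+1)).
Proof.
move=> Ek; have ek := Ek.1; elim: n => [|n IH].
  split=> [|phi e ea].
    apply: Vset_mono; apply: (ord_trans _ (crseq_lt 0 Ek)).
    exact/(lam_ord hlam)/crseq_lam.
  have VM := Vset_crseqM 0 Ek.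
  pose P e := sat (e 0) (fun i => e i.+1) phi.
  have dP : definable P := @definable_sat phi 0 S.
  have eM n : scons (Vset (cr k)) e n ∈ M.
    by apply: sconsM => // i; apply: memM VM; apply: ea.
  have -> : sat (Vset (crseq k 0)) e phi <->
      sat (app k (Vset (cr k))) (fun i => app k (e i)) phi := elem ek dP eM.
  rewrite (app_Vset hlam ek (cr_lam hlam Ek)).
  suff -> : (fun i => app k (e i)) = e by [].
  by apply: funext => i; apply: (cr_fixed_V hlam Ek (ea i)).
have := esub_app ek (Vset_crseqM n Ek) (Vset_crseqM n.+1 Ek) _ IH.
rewrite !(app_Vset hlam ek) ?(crseq_lam _ Ek) //; try exact: crseq_lam.
by apply; apply/empty_lim/crseq_lim.
Qed.

End CriticalSequence.

Section Application.
Variable lam : zfset.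
Hypothesis hlam : lim lam.
Local Notation M := (Vset lam).
Local Notation definable := (definable lam).

Lemma capM k u : u ∈ M -> zcap k u ∈ M.
Proof. by move=> uM; apply: (Vset_down uM) => p /mem_zcap[]. Qed.

Lemma zfunction_app f A B x y : zfunction f A B -> prel f x y -> app f x = y.
Proof.
move=> [f1 f2] xy; have [x' [y' [xA _ e]]] := f1 _ xy.
have [ex _] := opair_inj e; rewrite -ex in xA.
have [z [_ uz]] := f2 _ xA.
by apply: xget_unique => //= z' xz'; rewrite -(uz _ xy) (uz _ xz').
Qed.

Section TwoEmbeddings.
Variables j k : zfset.
Hypothesis ej : elementary M j.
Hypothesis ek : elementary M k.
Local Notation "j ⋅ k" := (application lam j k) (at level 40).

(** Any set of [V_λ] can replace the levels [V_α] in the definition of [j ⋅ k]. *)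
Lemma applicationP p : p ∈ j ⋅ k <-> exists2 u, u ∈ M & p ∈ app j (zcap k u).
Proof.
rewrite mem_zcup; split=> [[_ /mem_zimage[a al <-]]|[u uM]].
  by exists (Vset a) => //; apply: VsetM.
move=> pu; have [a al ua] := (mem_Vset _ _).1 uM.
exists (app j (zcap k (Vset a))); first by apply/mem_zimage; exists a.
have VM := VsetM al.
apply: ((app_sub ej (capM k uM) (capM k VM)).1 _ _ pu) => q /mem_zcap[qk qu].
by apply/mem_zcap; split=> //; apply: ua.
Qed.

Lemma prel_cap u x y : prel (zcap k u) x y <-> opair x y ∈ u /\ (x ∈ M /\ y = app k x).
Proof.
rewrite /prel mem_zcap; split=> [[/(graphP ek)? ?]//|[? /(graphP ek)]//].
Qed.

Lemma app_cap_total u v w : u ∈ M -> v ∈ M -> w ∈ M ->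
  (forall x, x ∈ v -> opair x (app k x) ∈ u /\ app k x ∈ w) ->
  forall x, x ∈ app j v -> exists2 y, y ∈ app j w & prel (app j (zcap k u)) x y.
Proof.
move=> uM vM wM vu; pose P f v w := forall x, x ∈ v -> exists2 y, y ∈ w & prel f x y.
have dP : definable (fun e => P (e 0) (e 1) (e 2)).
  by apply: definable_ball; apply: definable_bex; apply: (@prel_definable _ 2 1 0).
apply: (elem3 ej (capM k uM) vM wM dP).1 => x xv; have [xu xw] := vu x xv.
by exists (app k x) => //; apply/prel_cap; split=> //; split=> //; apply: memM vM.
Qed.

Lemma application_fun : zfunction (j ⋅ k) M M.
Proof.
split=> [p /applicationP[u uM pu]|x xM].
  pose P f := forall p, p ∈ f -> exists2 x, x ∈ M & exists2 y, y ∈ M & p = opair x y.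
  have dP : definable (fun e => P (e 0)).
    by apply: definable_ball; do 2 apply: definable_ex; apply: (@opair_definable _ 2 1 0).
  have Pc : P (zcap k u).
    move=> q /mem_zcap[/(ek.1.1)[x [y [xM yM ->]]] _].
    by exists x => //; exists y.
  by have [x xM [y yM e]] := (elem1 ej (capM k uM) dP).1 Pc p pu; exists x, y.
have [a al xa] := lim_Vset_ex hlam xM.
have VM := VsetM al; have kVM := appM ek VM.
have [y yM xy] : exists2 y, y ∈ app j (app k (Vset a)) &
    prel (app j (zcap k (zprod (Vset a) (app k (Vset a))))) x y.
  apply: (app_cap_total (prodM hlam VM kVM) VM kVM).
    move=> z za; have H : app k z ∈ app k (Vset a).
      by apply: (app_mem ek _ VM).1 => //; apply: memM VM.
    by split=> //; apply/mem_zprod.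
  rewrite (app_Vset hlam ej al); apply: (Vset_mono _ xa).
  exact: (app_ge hlam ej al).
exists y; split=> [|z /applicationP[u uM xzu]].
  by apply/applicationP; exists (zprod (Vset a) (app k (Vset a))) => //; apply: prodM.
pose P f g := forall x, x ∈ M -> forall y, y ∈ M -> forall z, z ∈ M ->
  prel f x y -> prel g x z -> y = z.
have dP : definable (fun e => P (e 0) (e 1)).
  do 3 apply: definable_all; apply: definable_imp; first exact: (@prel_definable _ 3 2 1).
  by apply: definable_imp; [exact: (@prel_definable _ 4 2 0)|exact: (@definable_eq _ 1 0)].
have fM := capM k (prodM hlam VM kVM); have gM := capM k uM.
have [_ yM'] := prelM (appM ej fM) xy; have [_ zM'] := prelM (appM ej gM) xzu.
apply: ((elem2 ej fM gM dP).1 _ x xM y yM' z zM' xy xzu).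
by move=> a' _ b _ c _ /prel_cap[_ [_ ->]] /prel_cap[_ [_ ->]].
Qed.

Lemma app_application_cap u x y : u ∈ M -> prel (app j (zcap k u)) x y ->
  app (j ⋅ k) x = y.
Proof.
move=> uM xy; apply: (zfunction_app application_fun).
by apply/applicationP; exists u.
Qed.

Lemma app_application x : x ∈ M -> app (j ⋅ k) (app j x) = app j (app k x).
Proof.
move=> xM; have kM := appM ek xM; have pM := lim_opair hlam xM kM.
pose u := zpair (opair x (app k x)) (opair x (app k x)).
have uM : u ∈ M by apply: lim_zpair.
apply: (app_application_cap uM).
apply: (app_prel ej (capM k uM) xM kM).1; apply/prel_cap; split=> //.
by apply/mem_zpair; left.
Qed.

End TwoEmbeddings.

(** Put [κ_n] for the critical sequence of [k].  The restriction of [k] to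
    [V_(κ_n)] is elementary into [V_(κ_(n+1))], hence so is its image under [j], a
    restriction of [j ⋅ k] to [V_(j(κ_n))].  These levels are elementary in [V_λ],
    so the statement passes to [V_λ]. *)
Lemma application_elementary j k : Emb lam j -> Emb lam k ->
  elementary M (application lam j k).
Proof.
move=> Ej Ek; have ej := Ej.1; have ek := Ek.1.
set jk := application lam j k; split; first exact: application_fun.
move=> phi e eM; have [N HN] := sat_support phi.
pose a n := Vset (app j (crseq k n)).
have cl n : crseq k n ∈ lam by apply: crseq_lam.
have VM n : Vset (crseq k n) ∈ M := VsetM (cl n).
have aE n : a n = app j (Vset (crseq k n)) by rewrite (app_Vset hlam ej).
have V0 n : zempty ∈ Vset (crseq k n) := empty_lim (crseq_lim hlam n Ek).
have aM n : a n ⊆ M by move=> x xa; apply: (memM xa); rewrite aE; apply: appM.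
have mono m n : (m <= n)%N -> a m ⊆ a n.
  move=> /subnKC <-; elim: (n - m) => [|d IH]; first by rewrite addn0.
  rewrite addnS => x /IH; apply: Vset_mono; apply: (app_mono ej) => //.
  exact: (ord_trans (lam_ord hlam (cl _)) (crseq_lt hlam _ Ek)).
have cov x : x ∈ M -> exists n, x ∈ a n.
  move=> /(M_crseq hlam Ek)[n xn]; exists n.
  exact: (Vset_mono (app_ge hlam ej (cl n)) xn).
have asub n : esub (a n) M.
  apply: esub_chain => // m; rewrite !aE; apply: (esub_app hlam ej) => //.
  exact: (crseq_esub hlam).
pose pad (e : nat -> zfset) i := if (i < N)%N then e i else zempty.
have padP b e' : sat b e' phi <-> sat b (pad e') phi.
  by apply: HN => i iN; rewrite /pad iN.
have [n en] : exists n, forall i, pad e i ∈ a n.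
  rewrite /pad; elim: N {HN pad padP} => [|N [n IH]].
    exists 0 => i /=; rewrite aE -(app_empty hlam ej).
    apply: (app_mem ej _ (VM 0)).1 => //; exact: memM (VM 0).
  have [m em] := cov _ (eM N); exists (maxn n m) => i.
  rewrite ltnS leq_eqVlt; case: eqP => [->|_] /=; first exact/mono/em/leq_maxr.
  exact/mono/IH/leq_maxl.
pose f := zcap k (zprod (Vset (crseq k n)) (Vset (crseq k n.+1))).
have uM := prodM hlam (VM n) (VM n.+1); have fM : f ∈ M := capM k uM.
have kV : app k (Vset (crseq k n)) = Vset (crseq k n.+1) := app_Vset hlam ek (cl n).
have kVx x : x ∈ Vset (crseq k n) ->
    opair x (app k x) ∈ zprod (Vset (crseq k n)) (Vset (crseq k n.+1)) /\
    app k x ∈ Vset (crseq k n.+1).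
  move=> xV; have H : app k x ∈ Vset (crseq k n.+1).
    by rewrite -kV; apply: (app_mem ek _ (VM n)).1 => //; apply: memM (VM n).
  by split=> //; apply/mem_zprod.
have fe : eemb f (Vset (crseq k n)) (Vset (crseq k n.+1)).
  move=> psi x y xy.
  have -> : y = fun i => app k (x i).
    by apply: funext => i; case/(prel_cap ek): (xy i) => _ [].
  have xM i : x i ∈ M by case/(prel_cap ek): (xy i) => _ [].
  have eM' i : scons (Vset (crseq k n)) x i ∈ M by apply: sconsM.
  by rewrite -kV; apply: (elem ek (definable_sat lam psi 0 S) eM').
have f0 : exists x y, prel f x y.
  exists zempty, (app k zempty); apply/(prel_cap ek).
  split; first by case: (kVx _ (V0 n)).
  by split=> //; apply: memM (VM n).
have jfe := eemb_app ej fM (VM n) (VM n.+1) f0 fe.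
have pe i : app jk (pad e i) ∈ a n.+1 /\ prel (app j f) (pad e i) (app jk (pad e i)).
  have [|y yb xy] := app_cap_total ej ek uM (VM n) (VM n.+1) kVx (x := pad e i).
    by rewrite -aE.
  by rewrite aE /jk (app_application_cap ej ek uM xy).
rewrite padP -((asub n).2 phi _ en) aE (jfe phi _ _ (fun i => (pe i).2)) -aE.
rewrite ((asub n.+1).2 phi) => [|i]; last by case: (pe i).
rewrite (padP _ (fun i => app jk (e i))).
by apply: HN => i iN; rewrite /pad iN.
Qed.

Lemma application_Emb j k : Emb lam j -> Emb lam k -> Emb lam (application lam j k).
Proof.
move=> Ej Ek; have ejk := application_elementary Ej Ek; split=> //.
have [cl nc _] := crP hlam Ek; have cM := lam_M cl.
exists (app j (cr k)); apply/(movedP ejk); split; first exact: (appM Ej.1).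
rewrite (app_application Ej.1 Ek.1 cM) => /(app_inj Ej.1 _ cM) e.
by apply: nc; apply: e; apply: (appM Ek.1).
Qed.

Lemma cr_application j k : Emb lam j -> Emb lam k ->
  cr (application lam j k) = app j (cr k).
Proof.
move=> Ej Ek; have ej := Ej.1; have ek := Ek.1.
have [cl nc cf] := crP hlam Ek; have cM := lam_M cl.
apply: (cr_unique hlam (application_Emb Ej Ek)).
- exact: (app_lam hlam ej).
- by rewrite (app_application ej ek cM) => /(app_inj ej (appM ek cM) cM).
move=> b bj; pose P f c := forall x, x ∈ c -> prel f x x.
have dP : definable (fun e => P (e 0) (e 1)).
  by apply: definable_ball; apply: (@prel_definable _ 1 0 0).
have uM := prodM hlam cM cM.
apply: (app_application_cap ej ek uM).
apply: ((elem2 ej (capM k uM) cM dP).1 _ _ bj) => x xc; apply/(prel_cap ek).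
by split; [apply/mem_zprod|split; [exact: memM cM|rewrite cf]].
Qed.

(** Unlike [k ∩ u], the trace shows [k(x) ∩ u] even when [k(x)] is outside [u]. *)
Definition trace (u k : zfset) : zfset :=
  zsep (fun p => exists x y, p = opair x y /\ y ∈ app k x) u.

Lemma prel_trace u k x y : prel (trace u k) x y <-> opair x y ∈ u /\ y ∈ app k x.
Proof.
rewrite /prel mem_zsep; split=> [[pu [x' [y' [/opair_inj[<- <-] H]]]]//|[pu yx]].
by split=> //; exists x, y.
Qed.

Lemma traceM u k : u ∈ M -> trace u k ∈ M.
Proof. by move=> uM; apply: (Vset_down uM) => p /mem_zsep[]. Qed.

(** Thus the section at [trace u k] of the relation [y ∈ j(x)] is a trace of
    [j ⋅ k]. *)
Lemma app_trace j k u : Emb lam j -> Emb lam k -> u ∈ M -> ztrans u ->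
  app j (trace u k) = trace (app j u) (application lam j k).
Proof.
move=> Ej Ek uM tu; have ej := Ej.1; have ek := Ek.1.
have kuM := appM ek uM; have vM := prodM hlam uM kuM.
pose f := zcap k (zprod u (app k u)); have fM : f ∈ M := capM k vM.
have kux x : x ∈ u -> opair x (app k x) ∈ zprod u (app k u) /\ app k x ∈ app k u.
  move=> xu; have H : app k x ∈ app k u.
    by apply: (app_mem ek _ uM).1 => //; apply: memM uM.
  by split=> //; apply/mem_zprod.
have tot := app_cap_total ej ek vM uM kuM kux.
pose P t u f :=
  (forall p, p ∈ t -> p ∈ u /\ exists2 x, x ∈ M & exists2 y, y ∈ M &
     p = opair x y /\ exists2 z, z ∈ M & prel f x z /\ y ∈ z) /\
  (forall p, p ∈ u -> forall x, x ∈ M -> forall y, y ∈ M -> p = opair x y ->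
     forall z, z ∈ M -> prel f x z -> y ∈ z -> p ∈ t).
have dP : definable (fun e => P (e 0) (e 1) (e 2)).
  apply: definable_and.
    apply: definable_ball; apply: definable_and; first exact: definable_mem.
    do 2 apply: definable_ex; apply: definable_and; first exact: (@opair_definable _ 2 1 0).
    apply: definable_ex; apply: definable_and; last exact: definable_mem.
    exact: (@prel_definable _ 6 2 0).
  apply: definable_ball; do 2 apply: definable_all.
  apply: definable_imp; first exact: (@opair_definable _ 2 1 0).
  apply: definable_all; apply: definable_imp; first exact: (@prel_definable _ 6 2 0).
  by apply: definable_imp; apply: definable_mem.
have PT : P (trace u k) u f.
  split=> [p /mem_zsep[pu [x [y [e yx]]]]|p pu x xM y yM e z zM /(prel_cap ek)[_ [_ ->]] yx].
    rewrite e in pu; have xu := pair_meml tu pu; have yu := pair_memr tu pu.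
    have xM := memM xu uM; have yM := memM yu uM.
    split; first by rewrite e.
    exists x => //; exists y => //; split=> //; exists (app k x); first exact: appM.
    by split=> //; apply/(prel_cap ek); split=> //; case: (kux x xu).
  by rewrite e in pu *; apply/prel_trace.
have [P1 P2] := (elem3 ej (traceM k uM) uM fM dP).1 PT.
have juM := appM ej uM; have tju := app_trans ej uM tu.
apply: zext => p; split=> [/P1[pu [x xM [y yM [e [z zM [xz yz]]]]]]|].
  by rewrite e in pu *; apply/prel_trace; rewrite (app_application_cap ej ek vM xz).
move=> /mem_zsep[pu [x [y [e yx]]]]; rewrite e in pu.
have xu := pair_meml tju pu; have yu := pair_memr tju pu.
have [z zu xz] := tot x xu.
apply: (P2 p _ x (memM xu juM) y (memM yu juM) e z (memM zu (appM ej kuM)) xz).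
  by rewrite e.
by rewrite -(app_application_cap ej ek vM xz).
Qed.

End Application.

(** * No infinite descent of truncated embeddings *)

Section Descent.
Variable lam : zfset.
Hypothesis hlam : lim lam.
Local Notation M := (Vset lam).
Local Notation definable := (definable lam).

(** Closure under pairs lets a section at an element of [U] be computed inside [U];
    the levels [V_γ] with [γ] a limit are windows. *)
Definition window (U : zfset) : Prop := ztrans U /\
  forall x, x ∈ U -> forall y, y ∈ U -> exists2 p, p ∈ U & p = opair x y.

Lemma window_definable i : definable (fun e => window (e i)).
Proof.
rewrite /window; apply: definable_and; first exact: trans_definable.
do 2 apply: definable_ball; apply: definable_bex; exact: (@opair_definable _ 0 2 1).
Qed.

Lemma window_pair U x y : window U -> x ∈ U -> y ∈ U -> opair x y ∈ U.
Proof. by move=> [_ H] xU yU; have [p pU <-] := H x xU y yU. Qed.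

Definition section_at (U F K : zfset) : zfset := zsep (fun y => prel F K y) U.

Lemma mem_section U F K y : y ∈ section_at U F K <-> y ∈ U /\ prel F K y.
Proof. exact: mem_zsep. Qed.

Lemma section_definable i k l m : definable (fun e => e i = section_at (e k) (e l) (e m)).
Proof.
apply: (@definable_ext _ _ (fun e =>
  (forall y, y ∈ e i -> y ∈ e k /\ prel (e l) (e m) y) /\
  (forall y, y ∈ e k -> prel (e l) (e m) y -> y ∈ e i))).
  apply: definable_and; apply: definable_ball.
    by apply: definable_and; [exact: definable_mem|exact: (@prel_definable _ l.+1 m.+1 0)].
  by apply: definable_imp; [exact: (@prel_definable _ l.+1 m.+1 0)|exact: definable_mem].
move=> e _; split=> [->|[H1 H2]].
  by split=> [y /mem_section//|y yU yF]; apply/mem_section.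
by apply: zext => y; rewrite mem_section; split=> [/H1//|[]]; apply: H2.
Qed.

(** For [U = V_γ] and the trace [F] of an embedding [w], this says that some
    [b ∈ V_γ] has [V_γ ⊆ w(b)]; the power set of [b] is there because [U] itself is
    then an element of [w(zpow b)]. *)
Definition stretches (U F : zfset) : Prop :=
  exists2 b, b ∈ U & (exists2 q, q ∈ U & q = zpow b) /\
    forall y, y ∈ U -> prel F b y.

Lemma stretches_definable i k : definable (fun e => stretches (e i) (e k)).
Proof.
rewrite /stretches; apply: definable_bex; apply: definable_and.
  by apply: definable_bex; exact: (@pow_definable _ 0 1).
by apply: definable_ball; exact: (@prel_definable _ k.+2 1 0).
Qed.

(** Infinitely many sections in a row can be taken, at elements of [U] in the class
    [g], with all the sections stretching [U].  The set [Z] of the sections met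
    stands for the sequence, which spares a choice of the sequence and its coding
    inside [V_λ]. *)
Definition descends (g : zfset -> Prop) (U F : zfset) : Prop :=
  exists2 Z, Z ∈ M & (exists2 F0, F0 ∈ Z & F0 = zcap F U) /\
    forall F', F' ∈ Z -> stretches U F' /\
      exists2 K, K ∈ U & g K /\ exists2 Y, Y ∈ Z & Y = section_at U F' K.

Lemma descends_definable g i k : definable (fun e => descends (fun x => x ∈ e g) (e i) (e k)).
Proof.
rewrite /descends; apply: definable_ex; apply: definable_and.
  by apply: definable_bex; exact: (@cap_definable _ 0 k.+2 i.+2).
apply: definable_ball; apply: definable_and; first exact: (@stretches_definable i.+2 0).
apply: definable_bex; apply: definable_and; first exact: definable_mem.
by apply: definable_bex; exact: (@section_definable 0 i.+4 2 1).
Qed.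

Lemma descends_local (g g' : zfset -> Prop) U F :
  (forall x, x ∈ U -> g x -> g' x) -> descends g U F -> descends g' U F.
Proof.
move=> gg' [Z ZM [Z0 Z1]]; exists Z => //; split=> // F' /Z1[mF [K KU [gK KZ]]].
by split=> //; exists K => //; split=> //; apply: gg'.
Qed.

Lemma descends_cap g U F F' : zcap F U = zcap F' U -> descends g U F ->
  descends g U F'.
Proof. by move=> e [Z ZM [Z0 Z1]]; exists Z; rewrite -?e. Qed.

(** What an embedding does to descents: one from [K] whose first section is at [X]
    gives one from the relation [X] itself, in a smaller window. *)
Definition reflects (g : zfset -> Prop) (K : zfset) : Prop :=
  forall U, U ∈ M -> window U -> forall X, X ∈ U -> g X -> stretches U K ->
  forall Y, Y ∈ M -> Y = section_at U K X -> descends g U Y ->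
  exists2 U', U' ∈ U & window U' /\ descends g U' X.

Lemma reflects_definable g k : definable (fun e => reflects (fun x => x ∈ e g) (e k)).
Proof.
rewrite /reflects; apply: definable_all; apply: definable_imp; first exact: (@window_definable 0).
apply: definable_ball; apply: definable_imp; first exact: definable_mem.
apply: definable_imp; first exact: (@stretches_definable 1 k.+2).
apply: definable_all; apply: definable_imp; first exact: (@section_definable 0 2 k.+3 1).
apply: definable_imp; first exact: (@descends_definable g.+3 2 0).
apply: definable_bex; apply: definable_and; first exact: (@window_definable 0).
exact: (@descends_definable g.+4 0 2).
Qed.

(** If [K] stretches [U], then the elements of [U] are second coordinates of pairs
    in [K], hence [below] it. *)
Definition below (y K : zfset) : Prop := exists p q, [/\ y ∈ q, q ∈ p & p ∈ K].

Lemma below_wf : well_founded below.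
Proof.
suff H x : Acc below x /\ ((forall y, y ∈ x -> Acc below y) /\
    (forall y, y ∈ x -> forall z, z ∈ y -> Acc below z)).
  by move=> x; case: (H x).
elim/zmem_ind: x => x IH; split.
  by constructor=> z [y [w [zw wy yx]]]; apply: ((IH y yx).2.2 w).
split=> y yx; first by case: (IH y yx).
by move=> z; apply: (IH y yx).2.1.
Qed.

Lemma reflects_local (g g' : zfset -> Prop) K :
  (forall y, below y K -> g y <-> g' y) -> reflects g K -> reflects g' K.
Proof.
move=> gg' H U UM wU X XU g'X mU Y YM eY dY.
have UK y : y ∈ U -> below y K.
  move=> yU; have [b bU [_ /(_ y yU) bK]] := mU.
  by exists (opair b y), (zpair b y); split=> //; apply/mem_zpair; right.
have [||U' U'U [wU' dU']] := H U UM wU X XU _ mU Y YM eY.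
- exact/gg'/g'X/UK.
- by apply: descends_local dY => x /UK/gg'[].
exists U' => //; split=> //; apply: descends_local dU' => x xU'.
by apply: (gg' _ (UK _ _)).1; apply: (wU.1 _ U'U).
Qed.

(** The relations that reflect descents through [good] relations: a solution of
    [good K <-> reflects good K], found by recursion since only the elements below
    [K] matter on the right-hand side. *)
Definition good : zfset -> Prop :=
  Fix below_wf (fun=> Prop)
    (fun K rec => reflects (fun y => exists r : below y K, rec y r) K).

Lemma goodE K : good K <-> reflects good K.
Proof.
rewrite /good Fix_eq; last first.
  move=> x f f' ff'; congr reflects; apply: funext => y; congr ex.
  by apply: funext => r; apply: ff'.
by split; apply: reflects_local => y yK; split=> [h|h]; try (by exists yK); case: h.
Qed.

(** The definition of [good] within a transitive set [t]: [approx t g] is a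
    first-order condition with the only solution [g = good ∩ t] up to elements
    outside [t], so embeddings of [V_λ] respect [good]. *)
Definition approx (t g : zfset) : Prop := ztrans t /\
  forall K, K ∈ t -> (K ∈ g <-> reflects (fun x => x ∈ g) K).

Lemma approx_definable i k : definable (fun e => approx (e i) (e k)).
Proof.
rewrite /approx; apply: definable_and; first exact: trans_definable.
apply: definable_ball; apply: definable_iff; first exact: definable_mem.
exact: (@reflects_definable k.+1 0).
Qed.

Lemma below_trans t y K : ztrans t -> K ∈ t -> below y K -> y ∈ t.
Proof.
by move=> tt Kt [p [q [yq qp pK]]]; apply: (tt _ _ _ yq); apply: (tt _ _ _ qp);
   apply: (tt _ Kt).
Qed.

Lemma approxP t g : approx t g -> forall K, K ∈ t -> (K ∈ g <-> good K).
Proof.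
move=> [tt H]; apply: (well_founded_ind below_wf) => K IH Kt.
rewrite H // goodE; split; apply: reflects_local => y yK.
  by apply: IH => //; apply: below_trans yK.
by apply: iff_sym; apply: IH => //; apply: below_trans yK.
Qed.

Lemma approx_good t : ztrans t -> approx t (zsep good t).
Proof.
move=> tt; split=> // K Kt; rewrite mem_zsep goodE.
have E y : below y K -> good y <-> y ∈ zsep good t.
  by move=> /(below_trans tt Kt) yt; rewrite mem_zsep; split=> [|[]].
split=> [[_]|H]; first exact: (reflects_local E).
by split=> //; apply: reflects_local H => y yK; apply: iff_sym; apply: E.
Qed.

(** If [U ⊆ k(b)], then [U] belongs to [k(zpow b)] and carries a descent from
    [k(X)], because [section_at U (trace u k) X] and [k(X)] agree on [U].
    Elementarity of [k] gives a descent from [X] in some element of [zpow b ∈ U]. *)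
Lemma good_trace k u : Emb lam k -> u ∈ M -> ztrans u -> good (trace u k).
Proof.
move=> Ek uM tu; have ek := Ek.1; apply/goodE.
move=> U UM wU X XU gX [b bU [[q qU qE] bK]] Y YM eY dY.
have XM := memM XU UM; have bM := memM bU UM; have qM := memM qU UM.
have Ub y : y ∈ U -> opair b y ∈ u /\ y ∈ app k b.
  by move=> yU; apply/prel_trace/bK.
have Uu y : y ∈ U -> y ∈ u by move=> /Ub[/(pair_memr tu)].
have dX : descends good U (app k X).
  apply: descends_cap dY; rewrite eY; apply: zext => y; rewrite !mem_zcap mem_section.
  rewrite prel_trace; split=> [[[_ [_ yX]] yU]//|[yX yU]]; split=> //; split=> //.
  by split=> //; apply/Uu/window_pair.
have Uq : U ∈ app k q.
  by rewrite qE (app_pow hlam ek bM); apply/mem_zpow => y /Ub[].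
have [a al qa] := lim_Vset_ex hlam qM; pose t := Vset a; pose g := zsep good t.
have tM : t ∈ M := VsetM al; have tt : ztrans t := @Vset_trans a.
have gM : g ∈ M by apply: (Vset_down tM) => x /mem_zsep[].
have ag := approx_good tt.
have akg := (elem2 ek tM gM (approx_definable 0 1)).1 ag.
have akP := approxP akg.
pose P g q X := exists2 U, U ∈ q & window U /\ descends (fun x => x ∈ g) U X.
have dP : definable (fun e => P (e 0) (e 1) (e 2)).
  rewrite /P; apply: definable_bex; apply: definable_and; first exact: (@window_definable 0).
  exact: (@descends_definable 1 0 3).
have Pk : P (app k g) (app k q) (app k X).
  exists U => //; split=> //; apply: descends_local dX => x xU; apply: (akP _ _).2.
  apply: (akg.1 U) xU; apply: (akg.1 (app k q)) Uq.
  exact: (app_mem ek qM tM).1.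
have [U' U'q [wU' dU']] := (elem3 ek gM qM XM dP).2 Pk.
exists U'; first by apply: (wU.1 _ qU).
by split=> //; apply: descends_local dU' => x _ /mem_zsep[].
Qed.

(** The first step of the descent is at a good [K], and goodness of [F] moves the
    descent to [K] and to an element of [U]. *)
Lemma no_descent U F : U ∈ M -> window U -> good F -> ~ descends good U F.
Proof.
elim/zmem_ind: U F => U IH F UM wU gF [Z ZM [[F0 F0Z F0E] HZ]].
have [[b bU [qU bF]] [K KU [gK [Y YZ YE]]]] := HZ _ F0Z.
have YU : Y ⊆ U by rewrite YE => y /mem_section[].
have [|||U' U'U [wU' dU']] := (goodE F).1 gF U UM wU K KU gK _ Y (Vset_down UM YU).
- exists b => //; split=> // y /bF; rewrite F0E => /mem_zcap[]//.
- rewrite YE F0E; apply: zext => y; rewrite !mem_section /prel mem_zcap.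
  by split=> [[yU []]//|[yU yF]]; split=> //; split=> //; apply: window_pair.
- exists Z => //; split=> //; exists Y => //; apply: zsub_antisym => y.
    by move=> yY; apply/mem_zcap; split=> //; apply: YU.
  by move=> /mem_zcap[].
by apply: (IH U' U'U K _ wU' gK dU'); apply: memM UM.
Qed.

(** Laver and Steel: the class [Q] would contain the members of an infinite sequence
    [w, w ⋅ a, (w ⋅ a) ⋅ a', ...], and the traces of its members in [V_γ] form the
    set [Z] of a descent. *)
Lemma no_infinite_descent g (Q : zfset -> Prop) : lim g -> g ∈ lam ->
  (forall w, Q w -> [/\ Emb lam w, exists2 b, b ∈ g & g ⊆ app w b &
     exists a, Emb lam a /\ Q (application lam w a)]) ->
  forall w, ~ Q w.
Proof.
move=> lg gl HQ w Qw; have og := lim_ord lg; pose U := Vset g.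
have UM : U ∈ M := VsetM gl.
have wU : window U.
  split=> [|x xU y yU]; first exact: Vset_trans.
  by exists (opair x y) => //; apply: lim_opair.
have [Ew _ _] := HQ w Qw.
apply: (no_descent UM wU (good_trace Ew UM (@Vset_trans g))).
exists (zsep (fun t => exists2 v, Q v & t = trace U v) (zpow U)).
  by apply: (Vset_down (lim_pow hlam UM)) => t /mem_zsep[].
have tU v : trace U v ⊆ U by move=> p /mem_zsep[].
have tZ v : Q v -> trace U v ∈ zsep (fun t => exists2 v, Q v & t = trace U v) (zpow U).
  by move=> Qv; apply/mem_zsep; split; [apply/mem_zpow/tU|exists v].
split.
  exists (trace U w); first exact: tZ.
  by apply: zsub_antisym => [p pt|p /mem_zcap[]//]; apply/mem_zcap; split=> //; apply: (tU w).
move=> _ /mem_zsep[_ [v Qv ->]]; have [Ev [b bg gb] [a [Ea Qva]]] := HQ v Qv.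
have bl := ord_trans (lim_ord hlam) gl bg; have bM := VsetM bl.
have VbU : Vset b ∈ U by exact: Vset_mem.
have UVb : U ⊆ Vset (app v b) by exact: Vset_mono.
split.
  exists (Vset b) => //; split; first by exists (zpow (Vset b)) => //; apply: lim_pow.
  move=> y yU; apply/prel_trace; split; first exact: lim_opair.
  by rewrite (app_Vset hlam Ev.1 bl); apply: UVb.
exists (trace (Vset b) a); first by apply: (Vset_down VbU) => p /mem_zsep[].
split; first exact: (good_trace Ea bM (@Vset_trans b)).
exists (trace U (application lam v a)); first exact: tZ.
apply: zext => p; rewrite mem_section prel_trace.
rewrite (app_trace hlam Ev Ea bM (@Vset_trans b)) (app_Vset hlam Ev.1 bl).
rewrite !mem_zsep; split=> [[pU H]|[pU [_ [_ H]]]//].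
split=> //; split; last by split=> //; apply: UVb.
apply: lim_opair => //; apply: (Vset_down VbU) => q /mem_zsep[] //.
Qed.

End Descent.

(** * The critical points of the algebra *)

Lemma injection_infinite (T : Type) (A : set T) (f : nat -> T) :
  injective f -> (forall n, A (f n)) -> ~ finite_set A.
Proof.
move=> jf fA finA; apply: infinite_nat.
have -> : [set: nat] = f @^-1` A by apply/seteqP; split=> n //= _; apply: fA.
by apply: finite_preimage finA => x y _ _; apply: jf.
Qed.

Lemma infinite_injection (T : Type) (A : set T) : ~ finite_set A ->
  exists2 f : nat -> T, injective f & forall n, A (f n).
Proof.
move=> /infiniteP/card_leP[f].
exists (fun n => val (f (SigSub (mem_set (I : [set: nat] n))))).
  move=> m n /val_inj /(@inj _ _ _ f) e.
  by have := e (mem_set I) (mem_set I) => -[].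
by move=> n; apply: set_mem; apply: valP.
Qed.

Lemma order_type_omegaP (X : set zfset) : X !=set0 -> (forall x, X x -> ordinal_set x) ->
  (forall x, X x -> exists2 y, X y & x ∈ y) ->
  (forall x, X x -> finite_set [set y | X y /\ y ∈ x]) ->
  has_order_type_omega X.
Proof.
move=> [x0 Xx0] Xo Xup Xfin.
have [m Xm mmin] := @zmem_min X x0 Xx0.
have [next nextP] : {next : zfset -> zfset & forall x, X x ->
    [/\ X (next x), x ∈ next x & forall y, X y -> x ∈ y -> ~ y ∈ next x]}.
  apply: (@choice _ _ (fun x z => X x ->
    [/\ X z, x ∈ z & forall y, X y -> x ∈ y -> ~ y ∈ z])) => x.
  have [Xx|] := pselect (X x); last by exists x0.
  have [y Xy xy] := Xup x Xx.
  have [z [Xz xz] zmin] := @zmem_min (fun y => X y /\ x ∈ y) y (conj Xy xy).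
  by exists z => _; split=> // t Xt xt tz; apply: (zmin t tz).
pose e n := iter n next m.
have eX n : X (e n) by elim: n => [|n IH] //=; case: (nextP _ IH).
have eS n : e n ∈ e n.+1 by case: (nextP _ (eX n)).
have elt k n : (k < n)%N -> e k ∈ e n.
  elim: n => // n IH; rewrite ltnS leq_eqVlt => /orP[/eqP->//|/IH kn].
  exact: (ord_trans (Xo _ (eX n.+1)) (eS n) kn).
have ele k n : e k ∈ e n -> (k < n)%N.
  move=> kn; case: (ltngtP k n) => // [/elt nk|E]; first by case: (zmem_asym kn).
  by rewrite E in kn; case: (zmem_irr kn).
exists e; split; last by move=> k n; split; [apply: elt|apply: ele].
apply/seteqP; split=> [_ [n _ <-]//|x Xx]; apply: contrapT => nx.
have ne n : e n <> x by move=> E; apply: nx; exists n.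
have ex n : e n ∈ x.
  elim: n => [|n IH].
    by case: (ord_total (Xo _ (eX 0)) (Xo _ Xx)) => // [/ne//|/mmin].
  case: (ord_total (Xo _ (eX n.+1)) (Xo _ Xx)) => // [/ne//|xe].
  by case: (nextP _ (eX n)) => _ _ /(_ x Xx IH).
apply: (injection_infinite (f := e) _ _ (Xfin x Xx)) => // k n E.
case: (ltngtP k n) => // /elt; rewrite E; by move/zmem_irr.
Qed.

Section Truncation.
Variable lam : zfset.
Hypothesis hlam : lim lam.
Local Notation M := (Vset lam).
Local Notation "j ⋅ k" := (application lam j k) (at level 40).

Lemma mem_trace_Vset b c w p : b ⊆ c -> p ∈ Vset b ->
  p ∈ trace (Vset b) w <-> p ∈ trace (Vset c) w.
Proof.
move=> bc pb; rewrite !mem_zsep; split=> -[_ H]; split=> //.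
exact: Vset_mono pb.
Qed.

Lemma trace_mono b c w w' : b ⊆ c -> trace (Vset c) w = trace (Vset c) w' ->
  trace (Vset b) w = trace (Vset b) w'.
Proof.
move=> bc e; apply: zext => p.
by split=> pt; have [pb _] := (mem_zsep _ _ _).1 pt;
  move: pt; rewrite !(mem_trace_Vset _ bc pb) e.
Qed.

Section Level.
Variable g : zfset.
Hypothesis lg : lim g.
Hypothesis gl : g ∈ lam.
Local Notation tr w := (trace (Vset g) w).

Let og : ordinal_set g := lim_ord lg.

Lemma gsub b : b ∈ g -> b ∈ lam.
Proof. exact: (ord_trans (lim_ord hlam) gl). Qed.

(** All dependencies of the trace of [w ⋅ a] on [w] and [a] come from this
    description of it as a section. *)
Lemma mem_trace_application w a b p : Emb lam w -> Emb lam a -> b ∈ g ->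
  p ∈ Vset g -> p ∈ Vset (app w b) ->
  p ∈ tr (w ⋅ a) <-> prel (tr w) (trace (Vset b) a) p.
Proof.
move=> Ew Ea bg pg pwb; have bl := gsub bg.
have VbV : Vset b ∈ Vset g by exact: Vset_mem.
have tbV : trace (Vset b) a ∈ Vset g.
  by apply: (Vset_down VbV) => q /mem_zsep[].
rewrite prel_trace (app_trace hlam Ew Ea (VsetM bl) (@Vset_trans b)).
rewrite (app_Vset hlam Ew.1 bl) !mem_zsep.
split=> [[_ H]|[_ [_ H]]]; split=> //; exact: lim_opair.
Qed.

Lemma Vset_app w b p : Emb lam w -> b ∈ g -> p ∈ Vset b -> p ∈ Vset (app w b).
Proof. by move=> Ew bg; apply: Vset_mono; apply: (app_ge hlam Ew.1 (gsub bg)). Qed.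

Lemma trace_application_l w w' a : Emb lam w -> Emb lam w' -> Emb lam a ->
  tr w = tr w' -> tr (w ⋅ a) = tr (w' ⋅ a).
Proof.
move=> Ew Ew' Ea e; apply: zext => p.
have H : p ∈ Vset g -> p ∈ tr (w ⋅ a) <-> p ∈ tr (w' ⋅ a).
  move=> pg; have [b bg pb] := lim_Vset_ex lg pg.
  rewrite (mem_trace_application Ew Ea bg pg (Vset_app Ew bg pb)).
  by rewrite (mem_trace_application Ew' Ea bg pg (Vset_app Ew' bg pb)) e.
by split=> pt; have [pg _] := (mem_zsep _ _ _).1 pt; apply/H.
Qed.

Lemma trace_application_r w a a' b : Emb lam w -> Emb lam a -> Emb lam a' ->
  b ∈ g -> g ⊆ app w b -> trace (Vset b) a = trace (Vset b) a' ->
  tr (w ⋅ a) = tr (w ⋅ a').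
Proof.
move=> Ew Ea Ea' bg gb e; apply: zext => p.
have H : p ∈ Vset g -> p ∈ tr (w ⋅ a) <-> p ∈ tr (w ⋅ a').
  move=> pg; have pb : p ∈ Vset (app w b) by exact: Vset_mono pg.
  by rewrite (mem_trace_application Ew Ea bg pg pb) e
             -(mem_trace_application Ew Ea' bg pg pb).
by split=> pt; have [pg _] := (mem_zsep _ _ _).1 pt; apply/H.
Qed.

Lemma app_fixed_level j x : Emb lam j -> g ⊆ cr j -> x ∈ Vset g -> app j x = x.
Proof. by move=> Ej gj xg; apply: (cr_fixed_V hlam Ej); apply: Vset_mono xg. Qed.

(** A factor that is trivial below [γ] can be dropped on the left. *)
Lemma trace_application_id j k : Emb lam j -> Emb lam k -> g ⊆ cr j ->
  tr (j ⋅ k) = tr k.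
Proof.
move=> Ej Ek gj; apply: zext => p.
have H : p ∈ Vset g -> p ∈ tr (j ⋅ k) <-> p ∈ tr k.
  move=> pg; have [b bg pb] := lim_Vset_ex lg pg.
  have tV : trace (Vset b) k ∈ Vset g.
    by apply: (Vset_down (Vset_mem bg)) => q /mem_zsep[].
  rewrite (mem_trace_application Ej Ek bg pg (Vset_app Ej bg pb)) prel_trace.
  rewrite (app_fixed_level Ej gj tV) -(mem_trace_Vset k (ord_trans og bg) pb).
  split=> [[]//|H]; split=> //; exact: lim_opair.
by split=> pt; have [pg _] := (mem_zsep _ _ _).1 pt; apply/H.
Qed.

Lemma trace_id j k : Emb lam j -> Emb lam k -> g ⊆ cr j -> g ⊆ cr k -> tr j = tr k.
Proof.
move=> Ej Ek gj gk; apply: zext => p; rewrite !mem_zsep.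
split=> -[pg [x [y [e yx]]]]; split=> //; exists x, y; split=> //; move: yx;
  rewrite e in pg; have xg := pair_meml (@Vset_trans g) pg;
  by rewrite (app_fixed_level Ej gj xg) (app_fixed_level Ek gk xg).
Qed.

(** The critical point is the least [b] with [b ∈ w(b)], a pair that the trace shows. *)
Lemma cr_trace w w' : Emb lam w -> Emb lam w' -> tr w = tr w' -> cr w ∈ g ->
  cr w' = cr w.
Proof.
move=> Ew Ew' e cg; have [cl nc cf] := crP hlam Ew.
have diag b : b ∈ g -> b ∈ app w b <-> b ∈ app w' b.
  move=> bg; have bV := sub_Vset bg; have pV := lim_opair lg bV bV.
  have := prel_trace (Vset g) w b b; have := prel_trace (Vset g) w' b b.
  by rewrite e => -> [H1 H2]; split=> h; [case: H2|case: H1].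
apply: (cr_unique hlam Ew' cl) => [ce|b bc].
  have := (diag _ cg).1 (cr_lt hlam Ew); rewrite ce; exact: zmem_irr.
have bg := ord_trans og cg bc; have bl := gsub bg.
case: (ord_sub_mem (lam_ord hlam bl) (app_ord hlam Ew'.1 bl)
        (app_ge hlam Ew'.1 bl)) => // /(diag _ bg).2.
by rewrite cf // => /zmem_irr.
Qed.

Lemma cr_dichotomy w : Emb lam w -> cr w ∈ g \/ g ⊆ cr w.
Proof. by move=> Ew; apply: ord_memVsub og; apply: (cr_ord hlam Ew). Qed.

End Level.

Section Algebra.
Variable H : set zfset.
Hypothesis HE : H `<=` Emb lam.
Hypothesis Hfin : forall theta, theta ∈ lam -> finite_set [set h | H h /\ cr h ∈ theta].
Local Notation A := (Aclosure lam H).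

Lemma A_Emb w : A w -> Emb lam w.
Proof. by elim=> [h /HE//|j k _ Ej _ Ek]; apply: (application_Emb hlam). Qed.

Definition finitely_traced (g : zfset) : Prop :=
  finite_set [set t | exists2 w, A w & t = trace (Vset g) w].

(** If the level [γ] is the first at which infinitely many traces occur, then
    [γ] is either the next limit after some limit [η], or it is the limit of a
    countable sequence of limits, at which infinitely many elements are told
    apart.  A [w] that takes no smaller limit to [γ] or above would fix [η] in the
    first case and [γ] in the second, contrary to [kunen_cr], or to the choice of
    the critical point if this is [η]. *)
Lemma stretch_below g w : lim g -> g ∈ lam ->
  (forall b, lim b -> b ∈ g -> finitely_traced b) -> ~ finitely_traced g ->
  A w -> cr w ∈ g -> exists2 b, b ∈ g & lim b /\ g ⊆ app w b.
Proof.
move=> lg gl fing infg Aw cg; have Ew := A_Emb Aw; have ew := Ew.1.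
have og := lim_ord lg; have gs b : b ∈ g -> b ∈ lam by exact: gsub.
have [unb|] := pselect (forall b, b ∈ g -> exists2 c, c ∈ g & lim c /\ b ∈ c); last first.
  move=> /existsNP[b0 /not_implyP[b0g nb0]].
  have ob0 := ord_mem og b0g.
  pose eta := zcup (zsep lim g).
  have etaP x : x ∈ eta <-> exists2 b, b ∈ g & lim b /\ x ∈ b.
    rewrite mem_zcup; split=> [[b /mem_zsep[bg lb] xb]|[b bg [lb xb]]]; exists b => //.
    by apply/mem_zsep.
  have oeta : ordinal_set eta.
    by apply: ord_cup => b /mem_zsep[_ /lim_ord].
  have eb0 : eta ⊆ b0.
    move=> x /etaP[b bg [lb xb]]; case: (ord_memVsub ob0 (lim_ord lb)) => h.
      by case: nb0; exists b.
    exact: h.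
  have eg : eta ∈ g by exact: (ord_le_lt oeta ob0 og eb0 b0g).
  have lim_eta b : b ∈ g -> lim b -> b ⊆ eta.
    by move=> bg lb x xb; apply/etaP; exists b.
  have leta : lim eta.
    split=> //; first by apply: (lim_eta _ cg (cr_lim hlam Ew)); case: (cr_lim hlam Ew).
    move=> y /etaP[b bg [lb yb]]; apply/etaP; exists b => //; split=> //.
    by case: lb => _ _; apply.
  exists eta => //; split=> //.
  have el := gs _ eg; have owe := app_ord hlam ew el.
  case: (ord_memVsub owe og) => // weg.
  have le := lim_eta _ weg (app_lim ew (lam_M el) leta).
  have we : app w eta = eta := zsub_antisym le (app_ge hlam ew el).
  have ce := lim_eta _ cg (cr_lim hlam Ew).
  case: (ord_sub_mem (cr_ord hlam Ew) oeta ce) => [e|]; last first.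
    by move/(kunen_cr hlam Ew el we).
  by have [_ + _] := crP hlam Ew; rewrite e we.
apply: contrapT => no.
have [t jt tA] := infinite_injection infg.
have [v vP] := choice (fun n => let: ex_intro2 w Aw e := tA n in
  ex_intro (fun w => A w /\ t n = trace (Vset g) w) w (conj Aw e)).
have vd m n : m <> n -> trace (Vset g) (v m) <> trace (Vset g) (v n).
  by move=> mn e; apply: mn; apply: jt; rewrite (vP m).2 (vP n).2.
have [be beP] : {be : nat * nat -> zfset & forall mn, [/\ lim (be mn), be mn ∈ g &
    mn.1 <> mn.2 -> trace (Vset (be mn)) (v mn.1) <> trace (Vset (be mn)) (v mn.2)]}.
  apply: (@choice _ _ (fun (mn : nat * nat) b => [/\ lim b, b ∈ g &
    mn.1 <> mn.2 -> trace (Vset b) (v mn.1) <> trace (Vset b) (v mn.2)])) => -[m n] /=.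
  have [->|mn] := pselect (m = n); first by exists (cr w); split=> //; apply: (cr_lim hlam Ew).
  apply: contrapT => nob; apply: (vd m n mn); apply: zext => p.
  suff E : p ∈ Vset g -> p ∈ trace (Vset g) (v m) <-> p ∈ trace (Vset g) (v n).
    by split=> pt; have [pg _] := (mem_zsep _ _ _).1 pt; apply/E.
  move=> pg; have [b bg pb] := lim_Vset_ex lg pg; have [c cg' [lc bc]] := unb b bg.
  have pc : p ∈ Vset c.
    exact: (Vset_mono (ord_trans (lim_ord lc) bc) pb).
  rewrite -!(mem_trace_Vset _ (ord_trans og cg') pc).
  have -> // : trace (Vset c) (v m) = trace (Vset c) (v n).
  by apply: contrapT => ne; apply: nob; exists c.
pose c i := if unpickle i is Some mn then be mn else be (0, 0).
have cP i : lim (c i) /\ c i ∈ g.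
  by rewrite /c; case: unpickle => [mn|]; [case: (beP mn)|case: (beP (0, 0))].
have wc b : b ∈ g -> lim b -> app w b ∈ g.
  move=> bg lb; case: (ord_memVsub (app_ord hlam ew (gs _ bg)) og) => // h.
  by case: no; exists b.
apply: (kunen_cr hlam Ew gl) cg.
apply: (app_fixed_sup hlam Ew gl (c := c)) => [n|b bg|n]; try by case: (cP n); auto.
apply: contrapT => nb.
have [s sg [ls bs]] := unb b bg.
have cs i : c i ⊆ s.
  have [lc cig] := cP i; have ob := ord_mem og bg.
  case: (ord_memVsub (lim_ord lc) ob) => [cb|bc]; last by case: nb; exists i.
  exact: (ord_trans (lim_ord ls) (ord_trans (lim_ord ls) bs cb)).
apply: (@injection_infinite _ _ (fun n => trace (Vset s) (v n)) _ _ (fing s ls sg)).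
  move=> m n e; apply: contrapT => mn; have [_ _ /(_ mn)] := beP (m, n); apply.
  apply: trace_mono e; have := cs (pickle (m, n)); by rewrite /c pickleK.
by move=> n; exists (v n) => //; case: (vP n).
Qed.

Section Level.
Variable g : zfset.
Hypothesis lg : lim g.
Hypothesis gl : g ∈ lam.
Local Notation tr w := (trace (Vset g) w).

(** The tree for König's lemma: a product from the left is continued only while it is
    nontrivial below [γ], as the descent theorem requires of its members. *)
Inductive left_product : zfset -> zfset -> Prop :=
  | left_product_nil w : left_product w w
  | left_product_cons w a v : cr w ∈ g -> A a -> left_product (w ⋅ a) v ->
      left_product w v.

Lemma left_product_inv w v : left_product w v ->
  v = w \/ exists a, [/\ cr w ∈ g, A a & left_product (w ⋅ a) v].
Proof. by case=> [|{}w a {}v cw Aa p]; [left|right; exists a]. Qed.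

Lemma left_product_A w v : A w -> left_product w v -> A v.
Proof.
by move=> + p; elim: p => // {}w a {}v _ Aa _ IH Aw; apply/IH/Aclosure_app.
Qed.

Lemma left_product_rcons w v a : left_product w v -> cr v ∈ g -> A a ->
  left_product w (v ⋅ a).
Proof.
move=> p cv Aa; elim: p cv => [{}w|{}w b {}v cw Ab _ IH] cv.
  by apply: left_product_cons Aa _ => //; apply: left_product_nil.
by apply: (left_product_cons cw Ab); apply: IH.
Qed.

Lemma left_product_trace w w' v : A w -> A w' -> tr w = tr w' -> left_product w v ->
  exists2 v', left_product w' v' & tr v' = tr v.
Proof.
move=> + + + p; elim: p w' => [{}w|{}w a {}v cw Aa _ IH] w' Aw Aw' e.
  by exists w' => //; apply: left_product_nil.
have Ew := A_Emb Aw; have Ew' := A_Emb Aw'; have Ea := A_Emb Aa.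
have [||//|v' p' ev] := IH (w' ⋅ a); try exact: Aclosure_app.
  exact: trace_application_l.
exists v' => //; apply: left_product_cons Aa p'.
by rewrite (cr_trace lg gl Ew Ew' e cw).
Qed.

(** Induction on the generation of [w]: in [j ⋅ k], either [j] is trivial below [γ] and
    can be dropped, or a left product with the trace of [j] is continued by [k]. *)
Lemma left_product_gen w : A w -> cr w ∈ g ->
  exists h, [/\ H h, cr h ∈ g & exists2 v, left_product h v & tr v = tr w].
Proof.
elim=> [h Hh ch|j k Aj IHj Ak IHk cjk].
  by exists h; split=> //; exists h => //; apply: left_product_nil.
have Ej := A_Emb Aj; have Ek := A_Emb Ak; have Ejk := application_Emb hlam Ej Ek.
case: (cr_dichotomy lg Ej) => [cj|gj].
  have [h [Hh ch [v pv ev]]] := IHj cj; exists h; split=> //.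
  have Av := left_product_A (Aclosure_gen lam Hh) pv; have Ev := A_Emb Av.
  exists (v ⋅ k); last exact: trace_application_l.
  apply: left_product_rcons => //.
  by rewrite (cr_trace lg gl Ej Ev (esym ev) cj).
have e := trace_application_id lg gl Ej Ek gj.
have [|h [Hh ch [v pv ev]]] := IHk.
  by rewrite (cr_trace lg gl Ejk Ek e cjk).
by exists h; split=> //; exists v => //; rewrite e.
Qed.

Definition product_traces w : set zfset :=
  [set t | exists2 v, left_product w v & t = tr v].

Lemma product_traces_eq w w' : A w -> A w' -> tr w = tr w' ->
  product_traces w `<=` product_traces w'.
Proof.
move=> Aw Aw' e _ [v pv ->].
by have [v' pv' <-] := left_product_trace Aw Aw' e pv; exists v'.
Qed.

(** The infinite nodes in the sense of König's lemma. *)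
Definition wild w : Prop := [/\ A w, cr w ∈ g & ~ finite_set (product_traces w)].

Lemma wild_gen : ~ finitely_traced g -> exists h, wild h.
Proof.
move=> inf; apply: contrapT => no; apply: inf.
pose D := [set h | H h /\ cr h ∈ g].
pose triv := [set t | exists2 w, A w /\ g ⊆ cr w & t = tr w].
apply: (@sub_finite_set _ _ (triv `|` \bigcup_(h in D) product_traces h)).
  move=> _ [w Aw ->]; case: (cr_dichotomy lg (A_Emb Aw)) => cw; last by left; exists w.
  by right; have [h [Hh ch [v pv ev]]] := left_product_gen Aw cw; exists h; [|exists v].
rewrite finite_setU; split.
  have [[t [w [Aw gw] _]]|n] := pselect (triv !=set0); last first.
    apply: (@sub_finite_set _ _ set0); last exact: finite_set0.
    by move=> t Tt; apply: n; exists t.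
  apply: (@sub_finite_set _ _ [set tr w]); last exact: finite_set1.
  by move=> _ [w' [Aw' gw'] ->] /=; apply: trace_id => //; apply: A_Emb.
apply: bigcup_finite; first exact: Hfin.
move=> h [Hh ch]; apply: contrapT => n; apply: no; exists h; split=> //.
exact: Aclosure_gen.
Qed.

(** The subtree of [w ⋅ a] depends only on the trace of [w ⋅ a] in [V_γ], hence on
    the trace of [a] in [V_b]: finitely many subtrees. *)
Lemma wild_app w b : wild w -> b ∈ g -> g ⊆ app w b -> finitely_traced b ->
  exists a, A a /\ wild (w ⋅ a).
Proof.
move=> [Aw cw inf] bg gb finb; apply: contrapT => no; apply: inf.
pose D := [set t | exists2 a, A a & t = trace (Vset b) a].
pose F t := [set s | exists2 a, A a /\ t = trace (Vset b) a & product_traces (w ⋅ a) s].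
apply: (@sub_finite_set _ _ ([set tr w] `|` \bigcup_(t in D) F t)).
  move=> _ [v /left_product_inv[->|[a [_ Aa p]]] ->]; first by left.
  right; exists (trace (Vset b) a); first by exists a.
  by exists a => //; exists v.
rewrite finite_setU; split; first exact: finite_set1.
apply: bigcup_finite => // _ [a Aa ->].
apply: (@sub_finite_set _ _ (product_traces (w ⋅ a))).
  move=> s [a' [Aa' e]]; apply: product_traces_eq; try exact: Aclosure_app.
  by apply: (trace_application_r lg gl (A_Emb Aw) (A_Emb Aa') (A_Emb Aa) bg gb).
have Awa : A (w ⋅ a) := Aclosure_app Aw Aa.
case: (cr_dichotomy lg (A_Emb Awa)) => [cwa|gwa].
  by apply: contrapT => n; apply: no; exists a.
apply: (@sub_finite_set _ _ [set tr (w ⋅ a)]); last exact: finite_set1.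
move=> _ [v /left_product_inv[->|[a' [cwa _ _]]] ->] //.
by case: (@zmem_irr (cr (w ⋅ a))); apply: gwa.
Qed.

End Level.

Lemma all_finitely_traced g : lim g -> g ∈ lam -> finitely_traced g.
Proof.
move=> lg gl; apply: contrapT => inf.
have [m [lm ml infm] mmin] := @zmem_min
  (fun g => [/\ lim g, g ∈ lam & ~ finitely_traced g]) g (And3 lg gl inf).
have fin b : lim b -> b ∈ m -> finitely_traced b.
  move=> lb bm; apply: contrapT => nb; apply: (mmin b bm); split=> //.
  exact: (gsub ml).
have [h wh] := wild_gen lm ml infm.
apply: (no_infinite_descent hlam (Q := wild m) lm ml _ wh) => w ww.
have [Aw cw _] := ww.
have [b bm [lb mb]] := stretch_below lm ml fin infm Aw cw.
split; [exact: A_Emb|by exists b|].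
have [a [Aa wa]] := wild_app lm ml ww bm mb (fin b lb bm).
by exists a; split=> //; apply: A_Emb.
Qed.

Lemma finite_cr h theta : Emb lam h -> theta ∈ lam ->
  finite_set [set c | (exists2 k, A k & cr k = c) /\ c ∈ theta].
Proof.
move=> Eh tl; have [n tn] := crseq_cofinal hlam Eh tl.
set g := crseq h n in tn.
have lg : lim g := crseq_lim hlam n Eh; have gl : g ∈ lam := crseq_lam hlam n Eh.
pose f t := xget zempty [set c | exists2 w, A w &
  [/\ trace (Vset g) w = t, cr w ∈ g & cr w = c]].
apply: (@sub_finite_set _ _ (f @` [set t | exists2 w, A w & t = trace (Vset g) w]));
  last exact/finite_image/all_finitely_traced.
move=> _ [[w Aw <-] ct]; have cg : cr w ∈ g := ord_trans (lim_ord lg) tn ct.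
exists (trace (Vset g) w); first by exists w.
apply: xget_unique => [|_ [w' Aw' [e cg' <-]]]; first by exists w.
by apply/esym/(cr_trace lg gl (A_Emb Aw') (A_Emb Aw) e cg').
Qed.

End Algebra.
End Truncation.

Theorem theorem10 (lam : zfset) (H : set zfset) :
  limit_ordinal lam ->
  H !=set0 ->
  H `<=` Emb lam ->
  (forall theta, theta ∈ lam -> finite_set [set h | H h /\ cr h ∈ theta]) ->
  has_order_type_omega [set cr k | k in Aclosure lam H].
Proof.
move=> /limP hlam [h Hh] HE Hfin; have AE := A_Emb hlam HE.
apply: order_type_omegaP.
- by exists (cr h), h => //; apply: Aclosure_gen.
- by move=> _ [k /AE Ek <-]; apply: (cr_ord hlam Ek).
- move=> _ [k Ak <-]; have Ek := AE _ Ak.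
  exists (cr (application lam k k)).
    by exists (application lam k k) => //; apply: Aclosure_app.
  by rewrite (cr_application hlam Ek Ek); apply: (cr_lt hlam Ek).
move=> _ [k Ak <-].
have := finite_cr hlam HE Hfin (HE _ Hh) (cr_lam hlam (AE _ Ak)).
by apply: sub_finite_set => c [[w Aw e] cc]; split=> //; exists w.
Qed.
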